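(* Let $K\subset\mathbb P^n$ be a compact subset. Then $\widehat K^--K$ has locally positive Hausdorff $2$-measure; that is, for every point $x\in\widehat K^--K$ and every open neighborhood $U$ of $x$, the Hausdorff $2$-measure of $(\widehat K^--K)\cap U$ is positive.
   Context: Sections of $\mathcal O(d)$ over $\mathbb P^n$ are identified with homogeneous polynomials $P$ of degree $d$ on $\mathbb C^{n+1}$, with norm $\|\mathcal P([Z])\|=|P(Z)|/\|Z\|^d$. The projective hull $\widehat K$ of a compact set $K\subset\mathbb P^n$ is the set of $x\in\mathbb P^n$ for which there is a constant $C=C_x>0$ with $\|\mathcal P(x)\|\le C^d\sup_K\|\mathcal P\|$ for all $\mathcal P\in H^0(\mathbb P^n,\mathcal O(d))$ and all $d>0$. $\widehat K^-$ is the closure of $\widehat K$ in $\mathbb P^n$. *)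

(* Defs.v *)
From HB Require Import structures.
From mathcomp Require Import all_boot all_order all_algebra.
From mathcomp Require Import generic_quotient complex.
(* The notations of mpoly clash with those of mathcomp-analysis; its canonical
   instances are needed. *)
From mathcomp Require Import (coercions, canonicals) mpoly.
From mathcomp Require Import all_classical all_reals all_analysis.

Set Implicit Arguments.
Unset Strict Implicit.
Unset Printing Implicit Defensive.

Import Order.TTheory GRing.Theory Num.Theory.
Import numFieldNormedType.Exports.
Import ComplexField.Normc.

Local Open Scope classical_set_scope.
Local Open Scope ring_scope.
Local Open Scope quotient_scope.
Local Open Scope complex_scope.

(* [R[i]^o] is [R[i]] with its topology; the topology of ['rV[R[i]^o]_n.+1] is
   the product one, and a set coerced to a type has the induced topology. *)
Definition nonzero_vec (R : realType) (n : nat) : Type :=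
  [set v : 'rV[R[i]^o]_n.+1 | v != 0].

HB.instance Definition _ (R : realType) (n : nat) :=
  Topological.copy (nonzero_vec R n)
    (set_type [set v : 'rV[R[i]^o]_n.+1 | v != 0]).

Definition vec (R : realType) (n : nat) (z : nonzero_vec R n) :
  'rV[R[i]^o]_n.+1 := set_val z.

Section ProjectiveSpace.
Variables (R : realType) (n : nat).

Definition collinear (z w : nonzero_vec R n) : bool :=
  `[< exists2 c : R[i], c != 0 & vec z = c *: vec w >].

Lemma collinear_refl : reflexive collinear.
Proof. by move=> z; apply/asboolP; exists 1; rewrite ?oner_neq0 ?scale1r. Qed.

Lemma collinear_sym : symmetric collinear.
Proof.
suff H z w : collinear z w -> collinear w z by move=> z w; apply/idP/idP; exact: H.
move=> /asboolP[c c0 zw]; apply/asboolP; exists c^-1; first by rewrite invr_eq0.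
by rewrite zw scalerA mulVf // scale1r.
Qed.

Lemma collinear_trans : transitive collinear.
Proof.
move=> w z u /asboolP[a a0 zw] /asboolP[b b0 wu]; apply/asboolP.
by exists (a * b); [rewrite mulf_neq0|rewrite zw wu scalerA].
Qed.

Canonical collinear_equiv :=
  EquivRel collinear collinear_refl collinear_sym collinear_trans.

Definition projective_space : Type :=
  quotient_topology {eq_quot collinear_equiv}.

HB.instance Definition _ := Topological.copy projective_space
  (quotient_topology {eq_quot collinear_equiv}).
HB.instance Definition _ := Quotient.copy projective_space
  (quotient_topology {eq_quot collinear_equiv}).

End ProjectiveSpace.

Section HermitianNorm.
Variables (R : realType) (n : nat).
Implicit Types z w : 'rV[R[i]^o]_n.+1.

(* [`|z|] on row vectors is the maximum norm, hence a separate Hermitian one. *)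
Definition hdot z w : R[i] := \sum_i (z 0 i : R[i]) * (w 0 i)^*.
Definition hnorm z : R := Num.sqrt (\sum_i normc (z 0 i) ^+ 2).

Lemma hdotZl (c : R[i]) z w : hdot (c *: z) w = c * hdot z w.
Proof. by rewrite mulr_sumr; apply: eq_bigr => i _; rewrite mxE -mulrA. Qed.

Lemma hdotZr (c : R[i]) z w : hdot z (c *: w) = c^* * hdot z w.
Proof.
by rewrite mulr_sumr; apply: eq_bigr => i _; rewrite mxE rmorphM mulrCA.
Qed.

Lemma normc_conj (c : R[i]) : normc c^* = normc c.
Proof. by case: c => a b /=; rewrite sqrrN. Qed.

Lemma hnormZ (c : R[i]) z : hnorm (c *: z) = normc c * hnorm z.
Proof.
have c0 : 0 <= normc c by case: c => a b; exact: sqrtr_ge0.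
rewrite /hnorm -[in RHS](ger0_norm c0) -sqrtr_sqr -sqrtrM ?sqr_ge0//.
rewrite mulr_sumr; congr Num.sqrt; apply: eq_bigr => i _.
by rewrite mxE normcM exprMn.
Qed.

End HermitianNorm.

Section ProjectiveHull.
Variables (R : realType) (n : nat).
Local Notation PP := (projective_space R n).
Implicit Types (d : nat) (P : mpoly.mpoly n.+1 R[i]) (x y : PP) (K : set PP).

(* Pointwise norm of the section of O(d) given by [P]; it does not depend on the
   representative when [P] is homogeneous of degree [d]. *)
Definition section_norm d P x : R :=
  let z := vec (repr x) in
  normc (mpoly.meval (fun i => z 0 i) P) / hnorm z ^+ d.

Lemma vec_repr (z : nonzero_vec R n) :
  exists2 c : R[i], c != 0 & vec (repr (\pi_PP z)) = c *: vec z.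
Proof.
case: piP => w zw.
have /eqmodP/asboolP[c c0 ->] : z = w %[mod {eq_quot (collinear_equiv R n)}].
  exact: zw.
by exists c^-1; rewrite ?invr_eq0// scalerA mulVf// scale1r.
Qed.

Lemma meval_homogZ d P (v : 'I_n.+1 -> R[i]) (c : R[i]) :
  P \is mpoly.ishomog1 d mpoly.mdeg ->
  mpoly.meval (fun i => c * v i) P = c ^+ d * mpoly.meval v P.
Proof.
move=> /mpoly.dhomogP hP; rewrite !mpoly.mevalE big_distrr /=.
rewrite !big_seq; apply: eq_bigr => m Pm; rewrite mulrCA; congr (_ * _).
have -> : d = (\sum_i m i)%N by rewrite -mpoly.mdegE (hP m Pm).
rewrite expr_sum -big_split /=.
by apply: eq_bigr => i _; rewrite exprMn.
Qed.

Lemma section_norm_pi d P (z : nonzero_vec R n) :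
  P \is mpoly.ishomog1 d mpoly.mdeg ->
  section_norm d P (\pi_PP z) =
  normc (mpoly.meval (fun i => vec z 0 i) P) / hnorm (vec z) ^+ d.
Proof.
move=> hP; rewrite /section_norm; have [c c0 ->] := vec_repr z.
have -> : mpoly.meval (fun i => (c *: vec z) 0 i) P =
    c ^+ d * mpoly.meval (fun i => vec z 0 i) P.
  rewrite -(meval_homogZ _ _ hP).
  by apply: mpoly.meval_eq => i; rewrite mxE.
have nc0 : normc c != 0 by apply: contra_neq c0 => /eq0_normc.
have nX : normc (c ^+ d) = normc c ^+ d.
  by elim: d {hP} => [|d IH]; rewrite ?expr0 ?normc1 // !exprS normcM IH.
by rewrite normcM nX hnormZ exprMn -mulf_div divff ?expf_neq0 // mul1r.
Qed.

(* Equal to 0 for empty [K]; meaningful when the values are bounded, in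
   particular for compact [K]. *)
Definition sup_norm d P K : R := sup [set section_norm d P y | y in K].

Definition projective_hull K : set PP :=
  [set x | exists2 C : R, 0 < C &
    forall d P, (0 < d)%N -> P \is mpoly.ishomog1 d mpoly.mdeg ->
      section_norm d P x <= C ^+ d * sup_norm d P K].

(* Fubini-Study distance; the argument of [acos] lies in [0, 1] by
   Cauchy-Schwarz. *)
Definition fs_dist x y : R :=
  let z := vec (repr x) in let w := vec (repr y) in
  acos (normc (hdot z w) / (hnorm z * hnorm w)).

Lemma fs_dist_pi (z w : nonzero_vec R n) :
  fs_dist (\pi_PP z) (\pi_PP w) =
  acos (normc (hdot (vec z) (vec w)) / (hnorm (vec z) * hnorm (vec w))).
Proof.
rewrite /fs_dist; have [a a0 ->] := vec_repr z; have [b b0 ->] := vec_repr w.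
have na : normc a != 0 by apply: contra_neq a0 => /eq0_normc.
have nb : normc b != 0 by apply: contra_neq b0 => /eq0_normc.
rewrite hdotZl hdotZr !normcM normc_conj !hnormZ mulrA mulrACA -mulf_div.
by rewrite divff ?mulf_neq0 // mul1r.
Qed.

End ProjectiveHull.

Section Hausdorff2.
Local Open Scope ereal_scope.
Variables (R : realType) (T : Type) (dist : T -> T -> R).
Implicit Types A : set T.

(* The element [0] only matters for the empty set. *)
Definition diam A : \bar R :=
  ereal_sup (0 |` [set (dist x y)%:E | x in A & y in A]).

(* [pi / 4 * D ^+ 2] is the area of a disc of diameter [D]. *)
Definition hausdorff2_pre (delta : R) A : \bar R :=
  ereal_inf [set \sum_(i <oo) (pi / 4)%:E * diam (U i) ^+ 2 | U in
    [set U : (set T)^nat |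
      A `<=` \bigcup_i U i /\ forall i, diam (U i) <= delta%:E]].

Definition hausdorff2_measure A : \bar R :=
  ereal_sup [set hausdorff2_pre delta A | delta in [set e : R | (0 < e)%R]].

End Hausdorff2.

(* Main.v *)
Require Import Defs.
From mathcomp Require Import all_boot all_order all_algebra.
From mathcomp Require Import generic_quotient complex.
From mathcomp Require Import (coercions, canonicals) mpoly.
From mathcomp Require Import all_classical all_reals all_analysis.
From mathcomp Require Import ring lra zify.

(** The idea is that the closure of the projective hull satisfies, away from [K], a
    local maximum principle, and that a set of zero Hausdorff 2-measure cannot.

    Suppose that [S], the part of the closed hull in [U] and outside of [K], has
    measure zero. The quotient of two linear forms is a Lipschitz function where the
    denominator is bounded below, so its values on [S] form a set of zero area
    ([avoid_ratio]). This has two consequences: some hyperplane [f = 0] meets [S] at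
    most in the given point [x] ([generic_form]), and arbitrarily close to any number
    there are numbers [c] that are not values of [f] on [S]. In a small polydisc around
    [x] with an additional bound [|f| <= eps], the hull meets the boundary only where
    [|f| = eps]. For [c] close to the value of [f] at a point [xi] of the hull near [x],
    the function [1 / (f - c)] is holomorphic near the hull in the polydisc, and it is
    much larger at [xi] than on the boundary. This contradicts the maximum principle
    ([hull_measure_pos]).

    The maximum principle ([local_maximum]) is the projective version of Rossi's theorem
    on polynomial hulls. Its usual proof solves a Cousin problem; here this is done by
    elementary algebra, with seminorms on the algebra of polynomials in place of sheaves.
    Let [q] be a submultiplicative seminorm. Its spectrum consists of the characters
    bounded by [q], and by Gelfand's theorem ([exists_character]) the spectral radius
    of an element is the maximum of its modulus on the spectrum. The existence of
    characters is obtained from minimal seminorms, which are multiplicative, and from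
    Ostrowski's argument that a complex algebra with a multiplicative seminorm has only
    scalars modulo its kernel ([mazur]). Now let [h] be an element, and let [F] be small
    on the annulus [1 / 2 <= |h| <= 1] of the spectrum. Then a power of [F] is equal to
    a Laurent polynomial in [h] of small cost. Subtracting its regular part from this
    power of [F] leaves its principal part, so that the difference is close to the power
    of [F] for [|h| <= 1] and small for [|h| >= 1 / 2] ([laurent_split], [glue]). By
    induction over the functions [h] that define a polydisc, powers of [1 / (f - c)] in
    the polydisc are glued with [0] outside of it ([local_extension]); the inverse of
    [f - c] on the polydisc is itself approximated by polynomials, again by Gelfand's
    theorem ([approx_inverse]).

    The hull enters through the seminorm [chart_sn]: in the affine chart [Z_i0 = 1] a
    polynomial is presented as a sum of homogeneous polynomials [P_d], at the cost
    [\sum_d tau ^ d * ||P_d||_K]. Its spectrum consists of the points [v] of the chart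
    with [|P v| <= tau ^ d * ||P||_K] for all homogeneous [P] of degree [d], so that it
    lies in the hull. Let [G] be the polynomial obtained by gluing. Its powers have
    presentations of controlled cost, and truncating these at a suitable degree gives a
    homogeneous polynomial whose norm on [K] is too small compared with its value at
    [xi] ([growth_contradiction]). *)

Set Implicit Arguments.
Unset Strict Implicit.
Unset Printing Implicit Defensive.

Import Order.TTheory GRing.Theory Num.Theory.
Import numFieldNormedType.Exports.
Import ComplexField.Normc.

Local Open Scope classical_set_scope.
Local Open Scope ring_scope.
Local Open Scope quotient_scope.
Local Open Scope complex_scope.

(** * The modulus of a complex number *)

Section Modulus.
Variable R : realType.
Implicit Types x y : R[i].

Lemma normC_normc x : `|x| = (normc x)%:C.
Proof. by []. Qed.

Lemma normc_ge0 x : 0 <= normc x.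
Proof. by case: x => a b; exact: sqrtr_ge0. Qed.

Lemma normcD_le x y : normc (x + y) <= normc x + normc y.
Proof. exact: le_normcD. Qed.

Lemma normcN_eq x : normc (- x) = normc x.
Proof. exact: normcN. Qed.

Lemma normc0_eq0 x : (normc x == 0) = (x == 0).
Proof. by apply/eqP/eqP => [/eq0_normc//|->]; exact: normc0. Qed.

Lemma normc_gt0 x : (0 < normc x) = (x != 0).
Proof. by rewrite lt_neqAle normc_ge0 andbT eq_sym normc0_eq0. Qed.

Lemma normcB_ge x y : normc x - normc y <= normc (x + y).
Proof.
by rewrite lerBlDr -(normcN_eq y) -{1}(addrK y x) normcD_le.
Qed.

Lemma normc_real (r : R) : 0 <= r -> normc r%:C = r.
Proof. by move=> r0; rewrite /= expr0n /= addr0 sqrtr_sqr ger0_norm. Qed.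

Lemma normc_nat k : normc (k%:R : R[i]) = k%:R.
Proof.
have -> : (k%:R : R[i]) = (k%:R : R)%:C by rewrite rmorph_nat.
by rewrite normc_real// ler0n.
Qed.

Lemma normcX x k : normc (x ^+ k) = normc x ^+ k.
Proof. by elim: k => [|k IH]; rewrite ?expr0 ?normc1 // !exprS normcM IH. Qed.

Lemma normc_sum (I : Type) (s : seq I) (P : pred I) (f : I -> R[i]) :
  normc (\sum_(i <- s | P i) f i) <= \sum_(i <- s | P i) normc (f i).
Proof.
elim: s => [|i s IH]; first by rewrite !big_nil normc0.
rewrite !big_cons; case: (P i) => //.
by rewrite (le_trans (normcD_le _ _))// lerD2l.
Qed.

Lemma normc_ge_absRe x : `|complex.Re x| <= normc x.
Proof.
case: x => a b /=; rewrite -sqrtr_sqr ler_sqrt ?addr_ge0 ?sqr_ge0//.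
by rewrite lerDl sqr_ge0.
Qed.

Lemma normc_ge_absIm x : `|complex.Im x| <= normc x.
Proof.
case: x => a b /=; rewrite -sqrtr_sqr ler_sqrt ?addr_ge0 ?sqr_ge0//.
by rewrite lerDr sqr_ge0.
Qed.

Lemma normc_le_absReIm x : normc x <= `|complex.Re x| + `|complex.Im x|.
Proof.
case: x => a b /=; rewrite -(ger0_norm (addr_ge0 (normr_ge0 a) (normr_ge0 b))).
rewrite -sqrtr_sqr ler_sqrt ?sqr_ge0// sqrrD !real_normK ?num_real//.
by rewrite addrAC lerDl mulrn_wge0// mulr_ge0.
Qed.

End Modulus.

(** * Seminorms and characters of a commutative algebra *)

Section Seminorms.
Variables (R : realType) (A : comAlgType R[i]).
Implicit Types (q : A -> R) (a b h : A) (c : R[i]).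

Record seminorm q : Prop := Seminorm {
  sn_ge0 : forall a, 0 <= q a;
  snD : forall a b, q (a + b) <= q a + q b;
  snM : forall a b, q (a * b) <= q a * q b;
  snZ : forall c a, q (c *: a) <= normc c * q a;
  sn1 : q 1 <= 1 }.

Record character (chi : A -> R[i]) : Prop := Character {
  chD : forall a b, chi (a + b) = chi a + chi b;
  chM : forall a b, chi (a * b) = chi a * chi b;
  chZ : forall c a, chi (c *: a) = c * chi a;
  ch1 : chi 1 = 1 }.

(** The characters that are continuous for [q]; they form the spectrum of the
    completion of [A]. *)
Definition spectrum q (chi : A -> R[i]) : Prop :=
  character chi /\ forall a, normc (chi a) <= q a.

Section Basics.
Variables (q : A -> R) (hq : seminorm q).

Lemma sn0 : q 0 = 0.
Proof.
apply/le_anti; rewrite sn_ge0// andbT.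
by have := snZ hq 0 0; rewrite scale0r normc0 mul0r.
Qed.

Lemma snN a : q (- a) = q a.
Proof.
have H b : q (- b) <= q b.
  by have := snZ hq (-1) b; rewrite scaleN1r normcN_eq normc1 mul1r.
by apply/le_anti; rewrite H/= -{1}(opprK a) H.
Qed.

Lemma snB a b : q (a - b) <= q a + q b.
Proof. by rewrite -(snN b) snD. Qed.

Lemma snX a k : q (a ^+ k) <= q a ^+ k.
Proof.
elim: k => [|k IH]; first by rewrite !expr0 sn1.
by rewrite !exprS (le_trans (snM hq _ _))// ler_wpM2l ?sn_ge0.
Qed.

Lemma snXM a k m : q (a ^+ (k * m)) <= q (a ^+ k) ^+ m.
Proof. by rewrite exprM snX. Qed.

Lemma sn_sum (I : Type) (s : seq I) (P : pred I) (f : I -> A) :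
  q (\sum_(i <- s | P i) f i) <= \sum_(i <- s | P i) q (f i).
Proof.
elim: s => [|i s IH]; first by rewrite !big_nil sn0.
rewrite !big_cons; case: (P i) => //.
by rewrite (le_trans (snD hq _ _))// lerD2l.
Qed.

End Basics.

Section CharacterTheory.
Variables (chi : A -> R[i]) (hc : character chi).

Lemma ch0 : chi 0 = 0.
Proof. by have := chZ hc 0 0; rewrite scale0r mul0r. Qed.

Lemma chN a : chi (- a) = - chi a.
Proof. by have := chZ hc (-1) a; rewrite scaleN1r mulN1r. Qed.

Lemma chB a b : chi (a - b) = chi a - chi b.
Proof. by rewrite chD// chN. Qed.

Lemma chX a k : chi (a ^+ k) = chi a ^+ k.
Proof. by elim: k => [|k IH]; rewrite ?expr0 ?ch1// !exprS chM// IH. Qed.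

Lemma ch_sum (I : Type) (s : seq I) (P : pred I) (f : I -> A) :
  chi (\sum_(i <- s | P i) f i) = \sum_(i <- s | P i) chi (f i).
Proof.
elim: s => [|i s IH]; first by rewrite !big_nil ch0.
by rewrite !big_cons; case: (P i) => //; rewrite chD// IH.
Qed.

End CharacterTheory.

Section Gauge.
Variable P : A -> R -> Prop.

(** [P a t] is meant to say that [a] has a presentation of cost [t]: all seminorms
    below are infima of costs, and are seminorms because presentations can be added
    and multiplied. *)
Definition gauge a : R := inf [set t | P a t].

Hypotheses (P_ge0 : forall a t, P a t -> 0 <= t)
  (P_ex : forall a, exists t, P a t)
  (PD : forall a b t u, P a t -> P b u -> P (a + b) (t + u))
  (PM : forall a b t u, P a t -> P b u -> P (a * b) (t * u))
  (PZ : forall c a t, P a t -> P (c *: a) (normc c * t))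
  (P1 : P 1 1).

Lemma gauge_le a t : P a t -> gauge a <= t.
Proof. by move=> Pat; apply: ge_inf => //; exists 0 => u /P_ge0. Qed.

Lemma gauge_lt a t : gauge a < t -> exists2 u, P a u & u < t.
Proof.
move=> lt; have [//||u Pu] := @inf_adherent R [set t | P a t] (t - gauge a).
- by rewrite subr_gt0.
- by split; [exact: P_ex | exists 0 => u /P_ge0].
- by rewrite -/(gauge a) subrKC; exists u.
Qed.

Lemma gauge_ge a t : (forall u, P a u -> t <= u) -> t <= gauge a.
Proof. by move=> H; apply: lb_le_inf => [|u /H//]; exact: P_ex. Qed.

Lemma gauge_seminorm : seminorm gauge.
Proof.
have g0 a : 0 <= gauge a by apply: gauge_ge => u /P_ge0.
have sep (x y : R) : (forall e, 0 < e -> x <= y + e) -> x <= y by move/ler_addgt0Pr.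
split=> //.
- move=> a b; apply: sep => e e0.
  have [u Pu hu] := @gauge_lt a (gauge a + e / 2) ltac:(lra).
  have [v Pv hv] := @gauge_lt b (gauge b + e / 2) ltac:(lra).
  by rewrite (le_trans (gauge_le (PD Pu Pv)))//; lra.
- move=> a b; rewrite leNgt; apply/negP => lt.
  suff [u [v [Pu Pv uv]]] : exists u v, [/\ P a u, P b v & u * v < gauge (a * b)].
    by move: uv; rewrite ltNge (gauge_le (PM Pu Pv)).
  set x := gauge a in lt *; set y := gauge b in lt *.
  pose d := gauge (a * b) - x * y.
  have d0 : 0 < d by rewrite subr_gt0.
  pose e := Num.min 1 (d / (x + y + 2)).
  have xy0 : 0 < x + y + 2 by have := g0 a; have := g0 b; rewrite -/x -/y; lra.
  have e0 : 0 < e by rewrite lt_min ltr01 divr_gt0.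
  have e1 : e <= 1 by rewrite ge_min lexx.
  have ed : e * (x + y + 2) <= d.
    by rewrite -ler_pdivlMr// ge_min lexx orbT.
  have [u Pu hu] := @gauge_lt a (x + e) ltac:(rewrite -/x; lra).
  have [v Pv hv] := @gauge_lt b (y + e) ltac:(rewrite -/y; lra).
  exists u, v; split=> //.
  have := P_ge0 Pu; have := P_ge0 Pv => v0 u0.
  apply: le_lt_trans (ler_pM u0 v0 (ltW hu) (ltW hv)) _.
  have x0 : 0 <= x := g0 a. have y0 : 0 <= y := g0 b.
  have : (x + e) * (y + e) = x * y + e * (x + y + e) by ring.
  move=> ->; have : e * (x + y + e) < e * (x + y + 2) by rewrite ltr_pM2l//; lra.
  rewrite /d in ed *; lra.
- move=> c a; have [->|c0] := eqVneq c 0.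
    rewrite scale0r normc0 mul0r.
    by have [t Pt] := P_ex a; have := gauge_le (PZ 0 Pt); rewrite scale0r normc0 mul0r.
  have nc0 : 0 < normc c by rewrite normc_gt0.
  rewrite -ler_pdivrMl//; apply: gauge_ge => u Pu.
  by rewrite ler_pdivrMl//; exact: gauge_le (PZ _ Pu).
- exact: gauge_le P1.
Qed.

End Gauge.

End Seminorms.

(** * Existence of characters *)

(** Completeness of [R], for the intervals of center [x i] and radius [d i]: they
    meet pairwise, so the supremum of their left ends is in all of them. *)
Lemma nested_intervals (R : realType) (I : Type) (i0 : I) (x d : I -> R) :
  (forall i j, `|x i - x j| <= d i + d j) -> exists u, forall i, `|x i - u| <= d i.
Proof.
move=> H; pose S := [set x i - d i | i in setT].
have ub j : ubound S (x j + d j).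
  by move=> _ [i _ <-]; have := H i j; rewrite ler_norml => /andP[_]; lra.
have hS : has_sup S by split; [exists (x i0 - d i0), i0 | exists (x i0 + d i0)].
exists (sup S) => i; rewrite ler_norml.
have h1 : sup S <= x i + d i by apply: ge_sup => //; case: hS.
have h2 : x i - d i <= sup S by apply: ub_le_sup; [case: hS | exists i].
by apply/andP; split; lra.
Qed.

Section MultiplicativeSeminorm.
Variables (R : realType) (A : comAlgType R[i]) (p : A -> R).
Hypotheses (hp : seminorm p) (p1 : p 1 = 1)
  (pM : forall a b, p (a * b) = p a * p b).
Implicit Types (a b x : A) (c e : R[i]).

Let pC c : p (c *: 1) = normc c.
Proof.
apply/le_anti/andP; split; first by have := snZ hp c 1; rewrite p1 mulr1.
have [->|c0] := eqVneq c 0; first by rewrite normc0 (sn_ge0 hp).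
have nc0 : 0 < normc c by rewrite normc_gt0.
have := snZ hp c^-1 (c *: 1); rewrite scalerA mulVf// scale1r p1 normcV.
by rewrite ler_pdivlMl// mulr1.
Qed.

Let p_dist_ge a c : normc c - p a <= p (a - c *: 1).
Proof.
rewrite lerBlDr -pC; have {1}-> : c *: 1 = a - (a - c *: 1) by rewrite subKr.
by rewrite [leRHS]addrC (snB hp).
Qed.

Section LowerBound.
Variables (m : R) (x : A) (m0 : 0 < m).
Hypothesis (mx : forall c, m <= p (x - c *: 1)).

Let dist_pow k c : m ^+ (2 ^ k) <= p (x ^+ (2 ^ k) - c *: 1).
Proof.
elim: k c => [|k IH] c; first by rewrite expn0 !expr1.
have -> : x ^+ (2 ^ k.+1) - c *: 1 =
    (x ^+ (2 ^ k) - sqrtC c *: 1) * (x ^+ (2 ^ k) - (- sqrtC c) *: 1).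
  rewrite scaleNr opprK -subr_sqr expnS mulnC exprM; congr (_ - _).
  by rewrite exprZn expr1n sqrtCK.
rewrite pM expnS mulnC exprM expr2; have mk := ltW (exprn_gt0 (2 ^ k) m0).
by rewrite ler_pM.
Qed.

Let dist_pow_factor k e :
  p (x - e *: 1) * m ^+ (2 ^ k).-1 <= p (x ^+ (2 ^ k) - e ^+ (2 ^ k) *: 1).
Proof.
elim: k => [|k IH]; first by rewrite expn0 !expr1 expr0 mulr1.
have -> : x ^+ (2 ^ k.+1) - e ^+ (2 ^ k.+1) *: 1 =
    (x ^+ (2 ^ k) - e ^+ (2 ^ k) *: 1) * (x ^+ (2 ^ k) - (- e ^+ (2 ^ k)) *: 1).
  rewrite scaleNr opprK -subr_sqr expnS mulnC !exprM; congr (_ - _).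
  by rewrite exprZn expr1n.
have -> : (2 ^ k.+1).-1 = ((2 ^ k).-1 + 2 ^ k)%N.
  by have := expn_gt0 2 k; rewrite expnS /=; lia.
rewrite pM exprD mulrA ler_pM ?dist_pow//; last exact: ltW (exprn_gt0 _ _).
by rewrite mulr_ge0 ?(sn_ge0 hp)// ltW// exprn_gt0.
Qed.

(** For [N] a power of [2], [x ^ N - e ^ N] is the product of [x - e] and of
    differences of powers of [x] and scalars, which are bounded below by powers of
    [m]. *)
Lemma seminorm_ostrowski k e :
  p (x - e *: 1) <= m * ((p x / m) ^+ (2 ^ k) + (normc e / m) ^+ (2 ^ k)).
Proof.
have H := dist_pow_factor k e.
have mk : 0 < m ^+ (2 ^ k).-1 by rewrite exprn_gt0.
have E : m ^+ (2 ^ k) = m * m ^+ (2 ^ k).-1.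
  by rewrite -exprS prednK// expn_gt0.
rewrite -ler_pdivlMr// in H; apply: le_trans H _.
rewrite ler_pdivrMr// mulrAC -E !expr_div_n -mulrDl mulrC divfK ?gt_eqF ?exprn_gt0//.
rewrite (le_trans (snB hp _ _))// lerD ?(snX hp)//.
by rewrite (le_trans (snZ hp _ _))// p1 mulr1 normcX.
Qed.

End LowerBound.

Let bernoulli_ub (y : R) N : 0 <= y <= 1 -> (1 + y) ^+ N <= 1 + 3 ^+ N * y.
Proof.
move=> /andP[y0 y1]; elim: N => [|N IH]; first by rewrite !expr0; lra.
have t1 : 1 <= (3 : R) ^+ N by rewrite exprn_ege1//; lra.
rewrite !exprS; apply: (le_trans (ler_wpM2l _ IH)); first lra.
move: t1; move: (3 ^+ N) => t t1.
have h1 : 0 <= t * y * (1 - y) by rewrite !mulr_ge0//; lra.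
have h2 : 0 <= (t - 1) * y by rewrite mulr_ge0//; lra.
lra.
Qed.

Let pow_half_small (t : R) : 0 < t -> exists k, (1 / 2) ^+ (2 ^ k) < t.
Proof.
move=> t0; have [k kt] : exists k, t^-1 < k%:R.
  by exists (Num.bound t^-1); rewrite archi_boundP// invr_ge0 ltW.
exists k; rewrite expr_div_n expr1n mul1r invf_plt ?posrE ?exprn_gt0//.
rewrite (lt_trans kt)// -natrX ltr_nat.
by apply: (@ltn_trans (2 ^ k)); exact: ltn_expl.
Qed.

(** Ostrowski's form of the Gelfand-Mazur theorem. If the distance of [b] to the
    scalars were [m > 0], the factorisation of [x ^ N - e ^ N] would show that
    points [e] close to a near-minimum are near-minima as well; hence the
    distance would stay bounded, which is absurd. *)
Lemma mazur b : exists c, p (b - c *: 1) = 0.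
Proof.
pose D c := p (b - c *: 1).
pose m := inf [set D c | c in setT].
have lbD : has_lbound [set D c | c in setT].
  by exists 0 => _ [c _ <-]; exact: sn_ge0 hp _.
have mD c : m <= D c by apply: ge_inf => //; exists c.
have hD : has_inf [set D c | c in setT] by split=> //; exists (D 0), 0.
have near (t : R) : 0 < t -> exists c, D c < m + t.
  by move=> t0; have [_ [c _ <-] Hc] := inf_adherent t0 hD; exists c.
have m_ge0 : 0 <= m by apply: lb_le_inf => [|_ [c _ <-]]; [case: hD | exact: sn_ge0 hp _].
have shift c e : b - c *: 1 - e *: 1 = b - (c + e) *: 1.
  by rewrite scalerDl opprD addrA.
case: (ltgtP 0 m) m_ge0 => // [m0|m0] _; last first.
  (* If the infimum is [0], then [c] is at distance at most [D c + D c'] from [c'];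
     so there is a limit point, at which the infimum is attained. *)
  have close c c' : normc (c - c') <= D c + D c'.
    rewrite -pC; have -> : (c - c') *: 1 = (b - c' *: 1) - (b - c *: 1).
      by rewrite scalerBl opprB [RHS]addrC addrA subrK.
    by rewrite [leRHS]addrC (snB hp).
  have closeRe c c' : `|complex.Re c - complex.Re c'| <= D c + D c'.
    by rewrite -raddfB (le_trans (normc_ge_absRe _)).
  have closeIm c c' : `|complex.Im c - complex.Im c'| <= D c + D c'.
    by rewrite -raddfB (le_trans (normc_ge_absIm _)).
  have [u hu] := nested_intervals 0 closeRe.
  have [v hv] := nested_intervals 0 closeIm.
  exists (u +i* v); apply/le_anti; rewrite (sn_ge0 hp) andbT -/(D _).
  apply/ler_addgt0Pr => t t0; rewrite add0r.
  have [c] := near (t / 3) ltac:(lra); rewrite -m0 add0r => Dc.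
  have cz : normc (c - (u +i* v)) <= 2 * D c.
    by rewrite (le_trans (normc_le_absReIm _))// !raddfB/= mulr_natl mulr2n lerD.
  have : D (u +i* v) <= D c + normc (c - (u +i* v)).
    rewrite -(pC (c - _)) /D.
    have -> : b - (u +i* v) *: 1 = (b - c *: 1) + (c - (u +i* v)) *: 1.
      by rewrite scalerBl addrA subrK.
    exact: snD.
  by move: cz Dc; lra.
have step (t : R) : 0 < t -> exists2 u, 0 < u &
    forall c e, D c <= m + u -> normc e <= m / 2 -> D (c + e) <= m + t.
  move=> t0; have [k hk] : exists k, (1 / 2) ^+ (2 ^ k) < t / (2 * m).
    by apply: pow_half_small; rewrite divr_gt0// mulr_gt0.
  set N := (2 ^ k)%N in hk.
  have t3 : 0 < (3 : R) ^+ N by rewrite exprn_gt0//; lra.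
  pose y := Num.min 1 (t / (2 * m) / 3 ^+ N).
  have y0 : 0 < y by rewrite lt_min ltr01/= !divr_gt0// mulr_gt0.
  have y1 : y <= 1 by rewrite ge_min lexx.
  have yt : 3 ^+ N * y <= t / (2 * m) by rewrite mulrC -ler_pdivlMr// ge_min lexx orbT.
  exists (m * y) => [|c e Dc em]; first by rewrite mulr_gt0.
  have mx d : m <= p (b - c *: 1 - d *: 1) by rewrite shift; exact: mD.
  have := seminorm_ostrowski m0 mx k e; rewrite shift -/(D _) -/(D c) -/N => H.
  apply: le_trans H _.
  have Q1 : (D c / m) ^+ N <= (1 + y) ^+ N.
    rewrite lerXn2r ?nnegrE; try (by rewrite ?divr_ge0 ?(sn_ge0 hp)//; lra).
    by rewrite ler_pdivrMr// mulrDl mul1r (mulrC y).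
  have Q2 : (normc e / m) ^+ N <= (1 / 2) ^+ N.
    rewrite lerXn2r ?nnegrE ?divr_ge0 ?normc_ge0//; try lra.
    by rewrite ler_pdivrMr//; lra.
  have Q3 := @bernoulli_ub y N; rewrite (ltW y0) y1 in Q3.
  have S : (D c / m) ^+ N + (normc e / m) ^+ N <= 1 + t / (2 * m) + t / (2 * m).
    by have := Q3 isT; lra.
  rewrite (le_trans (ler_wpM2l (ltW m0) S))//.
  have -> : m * (1 + t / (2 * m) + t / (2 * m)) = m + t by field; lra.
  by [].
have far J : exists2 u, 0 < u &
    forall c e, D c <= m + u -> normc e <= J%:R * (m / 2) -> D (c + e) <= m + 1.
  elim: J => [|J [u u0 IH]].
    exists 1 => // c e Dc; rewrite mul0r => e0.
    have /eqP -> : e == 0 by rewrite -normc0_eq0; apply/eqP/le_anti; rewrite e0 normc_ge0.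
    by rewrite addr0.
  have [v v0 Hv] := step u u0; exists v => // c e Dc eJ.
  pose z : R := J.+1%:R; have z0 : 0 < z by rewrite ltr0Sn.
  pose d := e * (z^-1)%:C.
  have nd : normc d = normc e / z by rewrite normcM normc_real// invr_ge0 ltW.
  have -> : c + e = c + d + (e - d) by rewrite -addrA subrKC.
  apply: IH; first by apply: Hv => //; rewrite nd ler_pdivrMr// mulrC.
  have -> : e - d = e * (1 - z^-1)%:C by rewrite rmorphB mulrBr mulr1.
  have zi : 1 - z^-1 = J%:R / z by rewrite /z -natr1; field; rewrite natr1 pnatr_eq0.
  rewrite normcM zi normc_real ?divr_ge0 ?ler0n ?(ltW z0)//.
  by rewrite mulrCA ler_wpM2l// ler_pdivrMr// mulrC.
have [J HJ] : exists J : nat, 2 * (m + 1) < J%:R * (m / 2).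
  have m2 : 0 < m / 2 by lra.
  exists (Num.bound (2 * (m + 1) / (m / 2))); rewrite -ltr_pdivrMr//.
  by rewrite archi_boundP// divr_ge0//; lra.
have [u u0 Hu] := far J; have [c Dc] := near u u0.
have D1 := Hu c 0 (ltW Dc); rewrite addr0 normc0 in D1.
have J0 : 0 <= J%:R * (m / 2) by lra.
have D2 := Hu c (J%:R * (m / 2))%:C (ltW Dc).
rewrite normc_real// lexx -/m in D2.
have D3 : J%:R * (m / 2) - D c <= D (c + (J%:R * (m / 2))%:C).
  by have := p_dist_ge (b - c *: 1) (J%:R * (m / 2))%:C; rewrite shift normc_real.
by exfalso; have := D1 J0; have := D2 isT; lra.
Qed.

End MultiplicativeSeminorm.

Lemma exp_small (R : realType) (u t : R) : 0 <= u < 1 -> 0 < t ->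
  exists k, forall m, (k <= m)%N -> u ^+ m < t.
Proof.
move=> /andP[u0 u1] t0; pose d := 1 - u; have d0 : 0 < d by rewrite subr_gt0.
have B m : u ^+ m * (1 + m%:R * d) <= 1.
  elim: m => [|m IH]; first by rewrite mul0r addr0 mulr1.
  apply: le_trans IH; rewrite exprSr -mulrA ler_wpM2l ?exprn_ge0//.
  rewrite -natr1 (_ : u = 1 - d); last by rewrite /d; lra.
  have m0 : 0 <= m%:R :> R by [].
  have : 0 <= (m%:R + 1) * d ^+ 2 by rewrite mulr_ge0 ?sqr_ge0//; lra.
  by rewrite expr2; lra.
have td : 0 < t * d by rewrite mulr_gt0.
exists (Num.bound (t * d)^-1) => m km.
have md : 1 < m%:R * (t * d).
  apply: (@lt_le_trans _ _ ((Num.bound (t * d)^-1)%:R * (t * d))).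
    by rewrite -ltr_pdivrMr// div1r archi_boundP// invr_ge0 ltW.
  by rewrite ler_wpM2r ?ler_nat// ltW.
have md0 : 0 < 1 + m%:R * d by rewrite ltr_pwDl// mulr_ge0 ?ler0n// ltW.
have := B m; rewrite -ler_pdivlMr// => /le_lt_trans; apply.
by rewrite ltr_pdivrMr//; lra.
Qed.

Section SpectralRadius.
Variables (R : realType) (A : comAlgType R[i]) (h a : A) (s : R).
Hypothesis s_ge0 : 0 <= s.
Implicit Types (q p : A -> R) (b c : A).

(** This holds in particular for the seminorm of a localization in which [h] has an
    inverse of size at most [s ^-1]; it passes to characters, unlike a bound from
    below on [q h] alone. *)
Definition bounded_below q : Prop := forall b, s * q b <= q (h * b).

Definition non_contracting q : Prop := forall n, (0 < n)%N -> 1 <= q (a ^+ n).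

Let admissible p := [/\ seminorm p, bounded_below p & non_contracting p].

(** Minimal seminorms exist because the infimum of a chain of seminorms is a
    seminorm. *)
Let minimal_exists q : admissible q -> exists p, [/\ admissible p, forall b, p b <= q b &
  forall p', admissible p' -> (forall b, p' b <= p b) -> forall b, p b <= p' b].
Proof.
move=> gq; pose T := {p | admissible p /\ forall b, p b <= q b}.
pose t0 : T := exist _ q (conj gq (fun b => lexx _)).
pose r : rel T := fun x y => `[< forall b, sval y b <= sval x b >].
have [|||[p [gp pq]] pmin] := @ZL_preorder T t0 r; last first.
- exists p; split => // p' gp' p'p.
  have p'q b : p' b <= q b := le_trans (p'p b) (pq b).
  have := pmin (exist _ p' (conj gp' p'q)).
  by move=> /(_ ltac:(exact/asboolP))/asboolP.
- move=> S totS; have [[x0 Sx0]|S0] := pselect (exists x, S x); last first.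
    by exists t0 => x Sx; case: S0; exists x.
  have min2 x y : S x -> S y -> exists z, [/\ S z, forall b, sval z b <= sval x b
      & forall b, sval z b <= sval y b].
    move=> Sx Sy; case: (totS x y Sx Sy) => /asboolP H.
      by exists y.
    by exists x.
  pose P b t := exists2 x, S x & sval x b <= t.
  have gS (x : T) : admissible (sval x) by exact: (proj1 (svalP x)).
  have sn (x : T) : seminorm (sval x) by case: (gS x).
  have P_ge0 b t : P b t -> 0 <= t.
    by move=> [x _]; apply: le_trans; exact: sn_ge0 (sn x) _.
  have P_ex b : exists t, P b t by exists (sval x0 b), x0.
  have gs : seminorm (gauge P).
    apply: gauge_seminorm => //.
    + move=> b c t u [x Sx xt] [y Sy yu]; have [z [Sz zx zy]] := min2 x y Sx Sy.
      exists z => //; rewrite (le_trans (snD (sn z) _ _))// lerD//.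
        exact: le_trans xt.
      exact: le_trans yu.
    + move=> b c t u [x Sx xt] [y Sy yu]; have [z [Sz zx zy]] := min2 x y Sx Sy.
      exists z => //; rewrite (le_trans (snM (sn z) _ _))// ler_pM ?(sn_ge0 (sn z))//.
        exact: le_trans xt.
      exact: le_trans yu.
    + move=> c b t [x Sx xt]; exists x => //.
      by rewrite (le_trans (snZ (sn x) _ _))// ler_wpM2l ?normc_ge0.
    + by exists x0 => //; exact: sn1 (sn x0).
  have gg : admissible (gauge P).
    split=> // [b|n n0]; apply: gauge_ge => // u [x Sx xu]; apply: le_trans xu.
    + have [_ bx _] := gS x; apply: le_trans (bx b).
      by rewrite ler_wpM2l//; apply: gauge_le => //; exists x.
    + by have [_ _ /(_ n n0)] := gS x.
  have gq' b : gauge P b <= q b.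
    apply: gauge_le => //; exists x0 => //; exact: (proj2 (svalP x0)).
  exists (exist _ (gauge P) (conj gg gq')) => x Sx; apply/asboolP => b /=.
  by apply: gauge_le => //; exists x.
- by move=> x y z /asboolP xy /asboolP yz; apply/asboolP => b; exact: le_trans (yz b) (xy b).
- by move=> x; apply/asboolP.
Qed.

Section Minimal.
Variable p : A -> R.
Hypotheses (gp : admissible p)
  (pmin : forall p', admissible p' -> (forall b, p' b <= p b) -> forall b, p b <= p' b).

Let sp : seminorm p. Proof. by case: gp. Qed.

Let p1 : p 1 = 1.
Proof.
apply/le_anti; rewrite (sn1 sp)/=.
have [_ _ /(_ 1%N isT)] := gp; rewrite expr1 => a1.
have := snM sp 1 a; rewrite mul1r -ler_pdivrMr; last lra.
by rewrite divff//; lra.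
Qed.

(** The spectral radius [b |-> lim p (b ^+ n) ^ (1/n)] is again a seminorm of the
    same kind; by minimality it is [p]. *)
Let spectral_radius_le b t : 0 <= t ->
  (exists M, forall n, p (b ^+ n) <= M * t ^+ n) -> p b <= t.
Proof.
pose P b t := 0 <= t /\ exists M, forall n, p (b ^+ n) <= M * t ^+ n.
have P_ge0 c u : P c u -> 0 <= u by case.
have Pp c : P c (p c).
  by split; [exact: sn_ge0 | exists 1 => n; rewrite mul1r snX].
have P_ex c : exists u, P c u by exists (p c).
have M_ge0 c u M : (forall n, p (c ^+ n) <= M * u ^+ n) -> 0 <= M.
  by move=> /(_ 0%N); rewrite !expr0 mulr1; apply: le_trans; rewrite p1.
have gs : seminorm (gauge P).
  apply: gauge_seminorm => //.
  - move=> c d u v [u0 [M HM]] [v0 [N HN]]; split; first exact: addr_ge0.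
    have M0 := M_ge0 _ _ _ HM; have N0 := M_ge0 _ _ _ HN.
    exists (M * N) => n; rewrite !exprDn mulr_sumr.
    rewrite (le_trans (sn_sum sp _ _ _))//; apply: ler_sum => i _.
    have H k (x : A) : p (x *+ k) <= k%:R * p x.
      rewrite -scaler_nat (le_trans (snZ sp _ _))// normc_nat//.
    rewrite (le_trans (H _ _))// -[X in _ <= _ * X]mulr_natl [leRHS]mulrCA ler_wpM2l ?ler0n//.
    rewrite (le_trans (snM sp _ _))// mulrACA.
    by rewrite ler_pM ?(sn_ge0 sp).
  - move=> c d u v [u0 [M HM]] [v0 [N HN]]; split; first exact: mulr_ge0.
    exists (M * N) => n; rewrite !exprMn mulrACA (le_trans (snM sp _ _))//.
    by rewrite ler_pM ?(sn_ge0 sp).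
  - move=> z c u [u0 [M HM]]; split; first by rewrite mulr_ge0 ?normc_ge0.
    exists M => n; rewrite exprZn exprMn (le_trans (snZ sp _ _))// normcX mulrCA.
    by rewrite ler_wpM2l// exprn_ge0// normc_ge0.
  - by split=> //; exists 1 => n; rewrite !expr1n p1 mulr1.
have gg : admissible (gauge P).
  have [_ bp np] := gp; split=> // [c|n n0].
  - apply: gauge_ge => // u [u0 [M HM]].
    have [s0|s0] := eqVneq s 0; first by rewrite s0 mul0r.
    have sp0 : 0 < s by rewrite lt_neqAle eq_sym s0.
    rewrite -ler_pdivlMl// gauge_le//; split; first by rewrite mulr_ge0// invr_ge0.
    exists M => n; rewrite exprMn mulrCA exprVn ler_pdivlMl ?exprn_gt0//.
    rewrite (le_trans _ (HM n))// exprMn; move: (c ^+ n) => d.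
    elim: n d {HM} => [|n IH] d; first by rewrite !expr0 !mul1r.
    rewrite !exprSr -!mulrA (le_trans _ (IH _))//.
    by rewrite ler_wpM2l ?exprn_ge0.
  - apply: gauge_ge => // u [u0 [M HM]]; rewrite leNgt; apply/negP => u1.
    have M0 := M_ge0 _ _ _ HM.
    have [k hk] := @exp_small R u (M + 1)^-1 ltac:(by rewrite u0) ltac:(by rewrite invr_gt0; lra).
    have := np (n * k.+1)%N; rewrite muln_gt0 n0 exprM => /(_ isT).
    rewrite leNgt (le_lt_trans (HM _))//.
    have uk := hk k.+1 (leqnSn k).
    have : M * u ^+ k.+1 <= M * (M + 1)^-1 by rewrite ler_wpM2l// ltW.
    move=> /le_lt_trans; apply; rewrite ltr_pdivrMr; lra.
move=> t0 Ht; rewrite (le_trans (pmin gg _ _))// ?gauge_le// => c.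
by rewrite gauge_le.
Qed.

Let p_sqr b : p (b ^+ 2) = p b ^+ 2.
Proof.
apply/le_anti; rewrite (snX sp)/= leNgt; apply/negP => lt.
have pb0 : 0 < p b.
  rewrite lt_neqAle (sn_ge0 sp) andbT; apply: contraTneq lt => <-.
  by rewrite expr0n/= -leNgt (sn_ge0 sp).
pose u := Num.sqrt (p (b ^+ 2)); pose t := Num.max u (p b / 2).
have tpb : t < p b.
  rewrite gt_max ltr_pdivrMr// ltr_pMr// ltr1n andbT.
  by rewrite -(ger0_norm (ltW pb0)) -sqrtr_sqr ltr_sqrt// exprn_gt0.
have t0 : 0 < t by rewrite lt_max orbC divr_gt0.
have ut : p (b ^+ 2) <= t ^+ 2.
  rewrite -(sqr_sqrtr (sn_ge0 sp (b ^+ 2))) lerXn2r ?nnegrE ?sqrtr_ge0 ?(ltW t0)//.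
  by rewrite /t le_max lexx.
suff : p b <= t by rewrite leNgt tpb.
apply: spectral_radius_le; first exact: ltW.
exists (1 + p b / t) => n; rewrite -(odd_double_half n) -mul2n.
have pe : p (b ^+ (2 * n./2)) <= t ^+ (2 * n./2).
  by rewrite (le_trans (snXM sp _ _ _))// exprM lerXn2r ?nnegrE ?(sn_ge0 sp) ?exprn_ge0 ?(ltW t0).
have tn : 0 <= t ^+ (2 * n./2) by rewrite exprn_ge0 ?ltW.
case: (odd n); rewrite ?add0n ?add1n.
  rewrite !exprS (le_trans (snM sp _ _))// mulrA mulrDl divfK ?gt_eqF//.
  by rewrite ler_pM ?(sn_ge0 sp)//; lra.
by rewrite (le_trans pe)// ler_peMl// lerDl divr_ge0 ?ltW.
Qed.

Let p_pow b n : p (b ^+ n) = p b ^+ n.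
Proof.
have pow2 k : p (b ^+ (2 ^ k)) = p b ^+ (2 ^ k).
  elim: k => [|k IH]; first by rewrite expn0 !expr1.
  by rewrite expnS mulnC !exprM p_sqr IH.
apply/le_anti; rewrite (snX sp)/=.
have [pb|pb0] := eqVneq (p b) 0.
  rewrite pb expr0n; case: n => [|n] /=; first by rewrite expr0 p1.
  exact: sn_ge0.
have pb : 0 < p b by rewrite lt_neqAle (sn_ge0 sp) eq_sym pb0.
have nk : (n <= 2 ^ n)%N by rewrite ltnW// ltn_expl.
have := pow2 n; rewrite -(subnK nk) !exprD => H.
rewrite -(ler_pM2l (exprn_gt0 (2 ^ n - n) pb)) -H (le_trans (snM sp _ _))//.
by rewrite ler_wpM2r ?(sn_ge0 sp) ?(snX sp).
Qed.

(** For fixed [b] the seminorm [c |-> lim p (c * b ^+ n) / p b ^+ n] lies below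
    [p]; when it is again admissible, minimality forces [p] to be
    multiplicative in the factor [b]. *)
Let multiplicative_factor b : 0 < p b ->
  (forall m n, (0 < m)%N -> p b ^+ n <= p (a ^+ m * b ^+ n)) ->
  forall c, p (c * b) = p c * p b.
Proof.
move=> pb0 Hb; have pbX n : 0 < p b ^+ n by rewrite exprn_gt0.
pose P c t := 0 <= t /\ exists n, p (c * b ^+ n) <= t * p b ^+ n.
have P_ge0 c t : P c t -> 0 <= t by case.
have Pn c n : P c (p (c * b ^+ n) / p b ^+ n).
  split; first by rewrite divr_ge0 ?(sn_ge0 sp) ?ltW.
  by exists n; rewrite divfK ?gt_eqF.
have P_ex c : exists t, P c t by exists (p (c * b ^+ 0) / p b ^+ 0).
have gs : seminorm (gauge P).
  apply: gauge_seminorm => //.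
  - move=> c d t u [t0 [n Hn]] [u0 [m Hm]]; split; first exact: addr_ge0.
    exists (n + m)%N; rewrite mulrDl (le_trans (snD sp _ _))// mulrDl lerD//.
      rewrite !exprD !mulrA (le_trans (snM sp _ _))//.
      by rewrite ler_pM ?(sn_ge0 sp) ?(snX sp).
    rewrite addnC !exprD !mulrA (le_trans (snM sp _ _))//.
    by rewrite ler_pM ?(sn_ge0 sp) ?(snX sp).
  - move=> c d t u [t0 [n Hn]] [u0 [m Hm]]; split; first exact: mulr_ge0.
    exists (n + m)%N; rewrite !exprD mulrACA (le_trans (snM sp _ _))//.
    by rewrite mulrACA ler_pM ?(sn_ge0 sp).
  - move=> z c t [t0 [n Hn]]; split; first by rewrite mulr_ge0 ?normc_ge0.
    exists n; rewrite -scalerAl (le_trans (snZ sp _ _))// -mulrA.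
    by rewrite ler_wpM2l ?normc_ge0.
  - by split=> //; exists 0%N; rewrite !expr0 mulr1 p1 mul1r.
have gp' c : gauge P c <= p c.
  by rewrite (le_trans (gauge_le P_ge0 (Pn c 0%N)))// !expr0 mulr1 divr1.
have gg : admissible (gauge P).
  have [_ bp _] := gp; split=> // [c|n n0]; apply: gauge_ge => // u [u0 [m Hm]].
    rewrite (le_trans (ler_wpM2l s_ge0 (gauge_le P_ge0 (Pn c m))))//.
    rewrite mulrA ler_pdivrMr// (le_trans (bp _))//.
    by rewrite mulrA.
  by rewrite -(ler_pM2r (pbX m)) mul1r (le_trans (Hb _ _ n0) Hm).
move=> c; apply/le_anti; rewrite (snM sp)/= -ler_pdivlMr//.
have := le_trans (pmin gg gp' c) (gauge_le P_ge0 (Pn c 1%N)).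
by rewrite expr1.
Qed.

Let p_mul b c : p (b * c) = p b * p c.
Proof.
have [_ _ na] := gp.
have a1 : 1 <= p a by rewrite -[a]expr1 na.
have pa d : p (d * a) = p d * p a.
  apply: multiplicative_factor; first lra.
  move=> m n m0; rewrite -exprD p_pow exprD ler_peMl ?exprn_ge0 ?exprn_ege1//; lra.
have pam d m : p (d * a ^+ m) = p d * p a ^+ m.
  elim: m => [|m IH]; first by rewrite !expr0 !mulr1.
  by rewrite !exprSr !mulrA pa IH.
have [pc|pc0] := eqVneq (p c) 0.
  apply/le_anti; rewrite (snM sp) pc mulr0 (sn_ge0 sp)//.
have pc : 0 < p c by rewrite lt_neqAle (sn_ge0 sp) eq_sym pc0.
apply: multiplicative_factor => // m n m0.
by rewrite mulrC pam p_pow ler_peMr ?exprn_ge0 ?exprn_ege1// ltW.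
Qed.

Let minimal_character : exists chi, character chi /\ forall b, normc (chi b) = p b.
Proof.
have pZ (c : R[i]) : p (c *: 1) = normc c.
  have [->|c0] := eqVneq c 0; first by rewrite scale0r normc0 (sn0 sp).
  apply/le_anti; rewrite (le_trans (snZ sp _ _)) ?p1 ?mulr1//=.
  have := snZ sp c^-1 (c *: 1); rewrite scalerA mulVf// scale1r p1 normcV.
  by rewrite ler_pdivlMl ?mulr1// normc_gt0.
have ex b : exists c : R[i], p (b - c *: 1) = 0 by exact: mazur.
pose chi b := sval (cid (ex b)).
have chiP b : p (b - chi b *: 1) = 0 by exact: svalP (cid (ex b)).
have uniq b (c : R[i]) : p (b - c *: 1) = 0 -> chi b = c.
  move=> bc; apply/eqP; rewrite -subr_eq0 -normc0_eq0 -pZ; apply/eqP/le_anti.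
  rewrite (sn_ge0 sp) andbT.
  have -> : (chi b - c) *: 1 = (b - c *: 1) - (b - chi b *: 1).
    by rewrite scalerBl opprB [RHS]addrC addrA subrK.
  by rewrite (le_trans (snB sp _ _))// bc chiP addr0.
have zero x y : p x = 0 -> p y = 0 -> p (x + y) = 0.
  move=> x0 y0; apply/le_anti; rewrite (sn_ge0 sp) andbT.
  by rewrite (le_trans (snD sp _ _))// x0 y0 addr0.
exists chi; split.
  split=> [b c|b c|c b|]; apply: uniq.
  - rewrite scalerDl opprD addrACA; exact: zero.
  - have -> : b * c - (chi b * chi c) *: 1 =
        (b - chi b *: 1) * c + (chi b *: 1) * (c - chi c *: 1).
      rewrite mulrBl mulrBr addrA subrK; congr (_ - _).
      by rewrite -scalerAl mul1r scalerA.
    by apply: zero; rewrite p_mul ?chiP ?mul0r ?mulr0.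
  - have -> : c *: b - (c * chi b) *: 1 = c *: 1 * (b - chi b *: 1).
      by rewrite -scalerAl mul1r scalerBr scalerA.
    by rewrite p_mul chiP mulr0.
  - by rewrite scale1r subrr (sn0 sp).
move=> b; apply/le_anti/andP; split.
  rewrite -pZ -[leRHS]addr0 -(chiP b) -{1}(subKr b (chi b *: 1)).
  exact: snB.
have -> : normc (chi b) = p (chi b *: 1) + p (b - chi b *: 1) by rewrite chiP addr0 pZ.
by rewrite -{1}(subrKC (chi b *: 1) b) (snD sp).
Qed.

Lemma good_character : exists chi,
  [/\ character chi, forall b, normc (chi b) <= p b, s <= normc (chi h) & 1 <= normc (chi a)].
Proof.
have [chi [cchi Hchi]] := minimal_character; have [_ bp np] := gp.
exists chi; split=> // [b||].
- by rewrite Hchi.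
- by rewrite Hchi; have := bp 1; rewrite p1 !mulr1.
- by rewrite Hchi -[a]expr1 np.
Qed.

End Minimal.

(** The spectral radius is attained on the spectrum: Gelfand's theorem, with the
    additional control from below of one element. *)
Theorem exists_character q : seminorm q -> bounded_below q -> non_contracting q ->
  exists chi, [/\ spectrum q chi, s <= normc (chi h) & 1 <= normc (chi a)].
Proof.
move=> sq bq nq; have [p [gp pq pmin]] := minimal_exists (And3 sq bq nq).
have [chi [cchi chip sh ah]] := good_character gp pmin.
by exists chi; split=> //; split=> // b; exact: le_trans (chip b) (pq b).
Qed.

End SpectralRadius.

(** Gelfand's theorem as it is used below: after rescaling [t] to [1], some power of
    [a] is a contraction, and the powers of this power tend to [0]. *)
Theorem spectral_radius_lt (R : realType) (A : comAlgType R[i]) (q : A -> R)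
    (h a : A) (s t : R) :
  seminorm q -> 0 <= s -> bounded_below h s q -> 0 < t ->
  (forall chi, spectrum q chi -> s <= normc (chi h) -> normc (chi a) < t) ->
  exists2 n, (0 < n)%N & forall e, 0 < e ->
    exists k, forall m, (k <= m)%N -> q (a ^+ (n * m)) < e * t ^+ (n * m).
Proof.
move=> sq s0 bq t0 H; pose b := (t^-1)%:C *: a.
have ti : 0 <= t^-1 by rewrite invr_ge0 ltW.
have ab : a = t%:C *: b.
  by rewrite /b scalerA -rmorphM divff ?gt_eqF// scale1r.
have [nb|] := pselect (non_contracting b q).
  have [chi [[cchi chiq] sh]] := exists_character s0 sq bq nb.
  rewrite chZ// normcM normc_real// mulrC ler_pdivlMr// mul1r leNgt H//.
move=> /existsNP[n /not_implyP[n0 /negP]]; rewrite -ltNge => qn.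
exists n => // e e0.
have [|k Hk] := @exp_small R (q (b ^+ n)) e _ e0; first by rewrite (sn_ge0 sq).
exists k => m km; apply: le_lt_trans (_ : q (b ^+ n) ^+ m * t ^+ (n * m) < _).
  rewrite ab exprZn (le_trans (snZ sq _ _))// normcX normc_real ?(ltW t0)// mulrC.
  by rewrite ler_wpM2r ?(snXM sq)// exprn_ge0// ltW.
by rewrite ltr_pM2r ?exprn_gt0// Hk.
Qed.

(** * Laurent presentations *)

Section Laurent.
Variables (R : realType) (A : comAlgType R[i]) (h : A) (q : A -> R).
Hypothesis sq : seminorm q.
Implicit Types (a b : A) (l : seq (A * nat)).

Section Presentations.
Variable loc : bool.

(** For [loc = false] this presents [a] as a polynomial in [h]; for [loc = true] as
    a Laurent polynomial, the denominator [h ^+ m] being cleared. The powers of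
    [h ^-1] have weight [2], by the truncated subtraction in the exponent. *)
Definition presented a (t : R) : Prop := exists m l,
  [/\ loc || (m == 0%N), a * h ^+ m = \sum_(x <- l) x.1 * h ^+ x.2
    & \sum_(x <- l) q x.1 * 2 ^+ (m - x.2) <= t].

Definition laurent : A -> R := gauge presented.

Lemma presented_ge0 a t : presented a t -> 0 <= t.
Proof.
move=> [m [l [_ _]]]; apply: le_trans.
by apply: sumr_ge0 => x _; rewrite mulr_ge0 ?(sn_ge0 sq) ?exprn_ge0.
Qed.

Lemma presented_self a : presented a (q a).
Proof.
by exists 0%N, [:: (a, 0%N)]; split;
  rewrite ?eqxx ?orbT// big_cons big_nil /= ?subnn !expr0 !mulr1 addr0.
Qed.

Lemma laurent_seminorm : seminorm laurent.
Proof.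
apply: gauge_seminorm.
- exact: presented_ge0.
- by move=> a; exists (q a); exact: presented_self.
- move=> a b t u [m [l [lm al lt]]] [m' [l' [lm' bl' lu]]].
  exists (m + m')%N, ([seq (x.1, (x.2 + m')%N) | x : A * nat <- l] ++ [seq (x.1, (x.2 + m)%N) | x : A * nat <- l']).
  split; first by case: loc lm lm' => //= /eqP -> /eqP ->.
    rewrite big_cat !big_map/= mulrDl {1}exprD mulrA al addnC exprD mulrA bl'.
    by rewrite !mulr_suml; congr (_ + _); apply: eq_bigr => x _; rewrite -mulrA -exprD.
  rewrite big_cat !big_map/= lerD//.
    apply: le_trans lt; rewrite le_eqVlt; apply/orP; left; apply/eqP.
    by apply: eq_bigr => x _; rewrite subnDr.
  apply: le_trans lu; rewrite le_eqVlt; apply/orP; left; apply/eqP.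
  by apply: eq_bigr => x _; rewrite addnC subnDr.
- move=> a b t u [m [l [lm al lt]]] [m' [l' [lm' bl' lu]]].
  exists (m + m')%N, [seq (x.1 * y.1, (x.2 + y.2)%N) | x : A * nat <- l, y : A * nat <- l'].
  split; first by case: loc lm lm' => //= /eqP -> /eqP ->.
    rewrite exprD mulrACA al bl' big_allpairs_dep mulr_suml; apply: eq_bigr => x _.
    by rewrite mulr_sumr; apply: eq_bigr => y _; rewrite /= mulrACA -exprD.
  have l0 : 0 <= \sum_(x <- l) q x.1 * 2 ^+ (m - x.2).
    by apply: sumr_ge0 => x _; rewrite mulr_ge0 ?(sn_ge0 sq) ?exprn_ge0.
  have l0' : 0 <= \sum_(x <- l') q x.1 * 2 ^+ (m' - x.2).
    by apply: sumr_ge0 => x _; rewrite mulr_ge0 ?(sn_ge0 sq) ?exprn_ge0.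
  apply: le_trans (ler_pM l0 l0' lt lu).
  rewrite big_allpairs_dep mulr_suml; apply: ler_sum => x _.
  rewrite mulr_sumr; apply: ler_sum => y _ /=.
  rewrite mulrACA ler_pM ?(sn_ge0 sq) ?(snM sq) ?exprn_ge0//.
  by rewrite -exprD ler_weXn2l ?ler1n//; lia.
- move=> c a t [m [l [lm al lt]]].
  exists m, [seq (c *: x.1, x.2) | x <- l]; split=> //.
    rewrite -scalerAl al scaler_sumr big_map; apply: eq_bigr => x _ /=.
    by rewrite scalerAl.
  rewrite big_map (le_trans _ (ler_wpM2l (normc_ge0 c) lt))// mulr_sumr.
  apply: ler_sum => x _ /=; rewrite mulrA ler_wpM2r ?exprn_ge0//.
  exact: snZ sq _ _.
- exists 0%N, [:: (1, 0%N)]; split;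
    rewrite ?eqxx ?orbT// big_cons big_nil /= ?subnn !expr0 !mulr1 addr0//.
  exact: sn1 sq.
Qed.

Lemma laurent_spectrum chi :
  spectrum laurent chi -> spectrum q chi /\ normc (chi h) <= 1.
Proof.
move=> [cc cq]; split.
  split=> // a; apply: le_trans (cq a) _; apply: gauge_le (presented_self a).
  exact: presented_ge0.
apply: le_trans (cq h) _; apply: gauge_le; first exact: presented_ge0.
exists 0%N, [:: (1, 1%N)]; split; rewrite ?eqxx ?orbT// big_cons big_nil /= addr0.
  by rewrite expr0 mulr1 mul1r expr1.
by rewrite sub0n expr0 mulr1 sn1.
Qed.

End Presentations.

Lemma laurent_bounded_below : bounded_below h (1 / 2) (laurent true).
Proof.
move=> b; apply: gauge_ge => [a|u [m [l [_ al lt]]]].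
  by exists (q a); exact: presented_self.
rewrite mulrC mul1r ler_pdivrMr// gauge_le//; first exact: presented_ge0.
exists m.+1, l; split=> //; first by rewrite exprS mulrA [b * h]mulrC.
rewrite (le_trans _ (ler_wpM2r _ lt))// mulr_suml; apply: ler_sum => x _.
rewrite -mulrA ler_wpM2l ?(sn_ge0 sq)// -exprSr ler_weXn2l ?ler1n//; lia.
Qed.

Lemma cell_spectrum chi : spectrum (laurent false) chi <->
  spectrum q chi /\ normc (chi h) <= 1.
Proof.
split=> [|[[cc cq] ch]]; first exact: laurent_spectrum.
split=> // a; apply: gauge_ge => [b|u [m [l [/eqP-> al]]]].
  by exists (q b); exact: presented_self.
apply: le_trans; rewrite -[a]mulr1 -(expr0 h) al ch_sum//.
rewrite (le_trans (normc_sum _ _ _))//; apply: ler_sum => x _.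
rewrite sub0n expr0 mulr1 chM// chX// normcM normcX.
by rewrite (le_trans _ (cq _))// ler_piMr ?normc_ge0 ?exprn_ile1 ?normc_ge0.
Qed.

(** Splitting a Laurent presentation of [F] of small cost into its regular part
    and its principal part. The element [G], which is [F] minus the regular part,
    is also the principal part; so it is close to [F] where [h] is at most [1] and
    small where [h] is at least [1 / 2]. *)
Lemma laurent_split F e : laurent true F < e -> exists G,
  (forall chi, spectrum q chi -> normc (chi h) <= 1 -> normc (chi G - chi F) <= e) /\
  (forall chi, spectrum q chi -> 1 / 2 <= normc (chi h) -> normc (chi G) <= e).
Proof.
move=> Fe; have [||u [m [l [_ Fl lu]]] ue] := gauge_lt _ _ Fe.
- exact: presented_ge0.
- by move=> a; exists (q a); exact: presented_self.
have le_e : \sum_(x <- l) q x.1 * 2 ^+ (m - x.2) <= e := le_trans lu (ltW ue).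
pose reg := \sum_(x <- l | (m <= x.2)%N) x.1 * h ^+ (x.2 - m).
have qx0 x : 0 <= q x.1 * 2 ^+ (m - x.2) by rewrite mulr_ge0 ?(sn_ge0 sq) ?exprn_ge0.
exists (F - reg); split=> chi [cc cq] ch.
  rewrite chB// addrAC subrr add0r normcN_eq ch_sum//.
  rewrite (le_trans (normc_sum _ _ _))// (le_trans _ le_e)// [leRHS](bigID (fun x => m <= x.2)%N)/=.
  rewrite -[leLHS]addr0 lerD ?sumr_ge0//; apply: ler_sum => x mx.
  rewrite chM// chX// normcM normcX (eqP mx) expr0 mulr1.
  by rewrite (le_trans _ (cq _))// ler_piMr ?normc_ge0 ?exprn_ile1 ?normc_ge0.
set y := normc (chi h) in ch.
have y0 : 0 < y by lra.
have Gh : (F - reg) * h ^+ m = \sum_(x <- l | ~~ (m <= x.2)%N) x.1 * h ^+ x.2.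
  rewrite mulrBl Fl [in LHS](bigID (fun x => m <= x.2)%N)/= addrC mulr_suml.
  rewrite -[RHS]addr0 -addrA; congr (_ + _); apply/eqP; rewrite subr_eq0; apply/eqP.
  by apply: eq_bigr => x mx; rewrite -mulrA -exprD subnK.
rewrite -(ler_pM2r (exprn_gt0 m y0)) -normcX -normcM -chX// -chM// Gh.
rewrite ch_sum// (le_trans (normc_sum _ _ _))//.
apply: (@le_trans _ _ (\sum_(x <- l) q x.1 * 2 ^+ (m - x.2) * y ^+ m)).
  rewrite [leRHS](bigID (fun x => ~~ (m <= x.2)%N))/= -[leLHS]addr0 lerD//.
    apply: ler_sum => x mx; rewrite chM// chX// normcM normcX -mulrA.
    rewrite ler_pM ?normc_ge0 ?exprn_ge0 ?normc_ge0//.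
    have xm : (x.2 <= m)%N by lia.
    rewrite -/y -{2}(subnK xm) exprD mulrA -exprMn ler_peMl ?exprn_ge0 ?(ltW y0)//.
    by rewrite exprn_ege1//; lra.
  by apply: sumr_ge0 => x _; rewrite mulr_ge0// exprn_ge0// ltW.
by rewrite -mulr_suml chX// normcX -/y ler_wpM2r// exprn_ge0// ltW.
Qed.

(** On the annulus [1 / 2 <= |h| <= 1] the spectrum of the Laurent seminorm only sees
    [|F| < t], so a large power of [F] has a Laurent presentation of small cost, and
    [laurent_split] glues this power with [0]. *)
Lemma glue F t : 0 < t ->
  (forall chi, spectrum q chi -> 1 / 2 <= normc (chi h) <= 1 -> normc (chi F) < t) ->
  forall e N, 0 < e -> exists k G, [/\ (0 < k)%N, (N <= k)%N,
    forall chi, spectrum q chi -> normc (chi h) <= 1 ->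
      normc (chi G - chi F ^+ k) <= e * t ^+ k &
    forall chi, spectrum q chi -> 1 / 2 <= normc (chi h) -> normc (chi G) <= e * t ^+ k].
Proof.
move=> t0 H e N e0.
have [|chi sc ch|n n0 /(_ e e0)[k Hk]] := spectral_radius_lt (h := h) (s := 1 / 2)
    (a := F) (laurent_seminorm true) _ laurent_bounded_below t0.
- lra.
- by have [sc' ch'] := laurent_spectrum sc; rewrite H// ch.
pose m := (k + N).+1; have km : (k <= m)%N by rewrite /m; lia.
have [G [G1 G2]] := laurent_split (Hk m km).
exists (n * m)%N, G; split=> // [||chi sc ch].
- by rewrite muln_gt0 n0.
- by rewrite (leq_trans _ (leq_pmull _ n0))// /m; lia.
- by rewrite -chX ?G1//; case: sc.
Qed.

End Laurent.

(** * Gluing along the faces of a cell *)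

Section Cells.
Variables (R : realType) (A : comAlgType R[i]).
Implicit Types (q : A -> R) (a b h : A) (hs : seq A) (chi : A -> R[i]).

Definition in_cell hs chi := all (fun h => normc (chi h) <= 1) hs.

Definition in_shell hs chi := has (fun h => 1 / 2 <= normc (chi h)) hs.

Definition cell hs q := foldl (fun p h => laurent h p false) q hs.

Lemma cell_seminorm hs q : seminorm q -> seminorm (cell hs q).
Proof. by elim: hs q => //= h hs IH q sq; apply: IH; exact: laurent_seminorm. Qed.

Lemma cellP hs q chi : seminorm q ->
  spectrum (cell hs q) chi <-> spectrum q chi /\ in_cell hs chi.
Proof.
elim: hs q => [|h hs IH] q sq /=; first by split=> // -[].
rewrite IH; last exact: laurent_seminorm.
rewrite cell_spectrum//; split; first by move=> [[? ->] ->].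
by move=> [? /andP[-> ->]].
Qed.

(** Otherwise the quotient of the cell seminorm by the ideal of [u] would be
    nontrivial; then it would have a character, at which [u] vanishes. *)
Lemma approx_inverse hs q u : seminorm q ->
  (forall chi, spectrum q chi -> in_cell hs chi -> chi u != 0) ->
  exists b, forall chi, spectrum q chi -> in_cell hs chi ->
    normc (1 - chi b * chi u) <= 1 / 2.
Proof.
move=> sq u0; pose p := cell hs q; have sp : seminorm p := cell_seminorm hs sq.
pose P a t := exists b, p (a - b * u) <= t.
have P_ge0 a t : P a t -> 0 <= t by move=> [b]; apply: le_trans; exact: sn_ge0 sp _.
have P_self a : P a (p a) by exists 0; rewrite mul0r subr0.
have P_ex a : exists t, P a t by exists (p a).
have sP : seminorm (gauge P).
  apply: gauge_seminorm => //.
  - move=> a c t v [b Hb] [d Hd]; exists (b + d).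
    by rewrite mulrDl opprD addrACA (le_trans (snD sp _ _))// lerD.
  - move=> a c t v [b Hb] [d Hd]; exists (a * d + b * (c - d * u)).
    have -> : a * c - (a * d + b * (c - d * u)) * u = (a - b * u) * (c - d * u) by ring.
    by rewrite (le_trans (snM sp _ _))// ler_pM ?(sn_ge0 sp).
  - move=> c a t [b Hb]; exists (c *: b).
    by rewrite -scalerAl -scalerBr (le_trans (snZ sp _ _))// ler_wpM2l ?normc_ge0.
  - by exists 0; rewrite mul0r subr0 sn1.
have bP : bounded_below 1 0 (gauge P) by move=> a; rewrite mul0r (sn_ge0 sP).
have half_gt0 : 0 < 1 / 2 :> R by lra.
have [chi [cc cP] _|n n0 H] := spectral_radius_lt (a := 1) sP (lexx 0) bP half_gt0.
  have sc : spectrum p chi.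
    by split=> // a; rewrite (le_trans (cP a))// gauge_le.
  have [sq' incell] := (cellP hs chi sq).1 sc.
  have /negP[] := u0 _ sq' incell.
  rewrite -normc0_eq0; apply/eqP/le_anti; rewrite normc_ge0 andbT.
  by rewrite (le_trans (cP u))// gauge_le//; exists 1; rewrite mul1r subrr (sn0 sp).
have [k /(_ k.+1 (leqnSn k))] := H 1 ltr01; rewrite expr1n mul1r => lt.
have [v [b Hb] vlt] := gauge_lt P_ge0 P_ex lt.
exists b => chi sc ic; have [cc cp] := (cellP hs chi sq).2 (conj sc ic).
have := cp (1 - b * u); rewrite chB// ch1// chM// => /le_trans; apply.
apply: le_trans Hb _; apply: le_trans (ltW vlt) _.
by rewrite -[leRHS]expr1 ler_wiXn2l ?muln_gt0 ?n0//; lra.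
Qed.

Let half_pow (x y : R) : 0 <= x -> x < y ->
  exists N, forall k, (N <= k)%N -> x ^+ k <= 1 / 2 * y ^+ k.
Proof.
move=> x0 xy; have y0 : 0 < y by lra.
have [||N HN] := @exp_small R (x / y) (1 / 2); last 1 first.
- exists N => k Nk; rewrite -ler_pdivrMr ?exprn_gt0// -expr_div_n.
  by rewrite ltW ?HN.
- by rewrite divr_ge0 ?(ltW y0)//= ltr_pdivrMr// mul1r.
- lra.
Qed.

(** Powers of [b] on the cell are glued with [0] outside of it along the functions of
    [hs], one at a time: the shell of the smaller cell and the annulus of the next
    function are where the glued element is already small. The conclusion compares
    only rates of growth, so that taking further powers preserves it. *)
Lemma local_extension hs q b xi (th0 th be0 be ga ga0 : R) :
  seminorm q -> spectrum q xi -> in_cell hs xi ->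
  0 <= th0 -> th0 < th -> th <= be0 -> be0 < be -> th <= ga -> ga < ga0 ->
  ga0 <= normc (xi b) ->
  (forall chi, spectrum q chi -> in_cell hs chi -> normc (chi b) <= be0) ->
  (forall chi, spectrum q chi -> in_cell hs chi -> in_shell hs chi ->
    normc (chi b) <= th0) ->
  exists k G, [/\ (0 < k)%N,
    forall chi, spectrum q chi -> ~~ in_cell hs chi || (normc (chi b) <= th0) ->
      normc (chi G) <= th ^+ k,
    forall chi, spectrum q chi -> normc (chi G) <= be ^+ k &
    ga ^+ k <= normc (xi G)].
Proof.
elim: hs q th be ga => [|h hs IH] q th be ga sq sxi cxi th00 thth thbe bebe thga gaga xib bbe bth.
  exists 1%N, b; rewrite !expr1; split=> //.
  - by move=> chi _ /= /le_trans; apply; exact: ltW.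
  - by move=> chi sc; rewrite (le_trans (bbe _ sc isT))// ltW.
  - by rewrite (le_trans _ xib)// ltW.
pose p := laurent h q false; have sp : seminorm p by exact: laurent_seminorm.
have pP chi : spectrum p chi <-> spectrum q chi /\ normc (chi h) <= 1 by exact: cell_spectrum.
have /andP[hxi cxi'] : (normc (xi h) <= 1) && in_cell hs xi by [].
have sxi' : spectrum p xi by apply/pP.
pose th' := (th0 + th) / 2; pose be' := (be0 + be) / 2; pose ga' := (ga + ga0) / 2.
have c1 : th0 < th' by rewrite /th'; lra.
have c2 : th' <= be0 by rewrite /th'; lra.
have c3 : be0 < be' by rewrite /be'; lra.
have c4 : th' <= ga' by rewrite /th' /ga'; lra.
have c5 : ga' < ga0 by rewrite /ga'; lra.
have [||k1 [G1 [k10 out1 all1 xi1]]] := IH p th' be' ga' sp sxi' cxi' th00 c1 c2 c3 c4 c5 xib.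
- by move=> chi /pP[sc hc] ic; apply: bbe => //=; rewrite hc.
- move=> chi /pP[sc hc] ic ish; apply: bth => //=; first by rewrite hc.
  by rewrite ish orbT.
have th0' : 0 < th by lra.
have ann chi : spectrum q chi -> 1 / 2 <= normc (chi h) <= 1 -> normc (chi G1) < th ^+ k1.
  move=> sc /andP[h1 h2]; apply: (@le_lt_trans _ _ (th' ^+ k1)); last first.
    by rewrite ltrXn2r -?lt0n//; rewrite /th'; lra.
  apply: out1; first by apply/pP.
  have [ic|//] := boolP (in_cell hs chi); rewrite /= bth//=; first by rewrite h2.
  by rewrite h1.
have [||N1 H1] := @half_pow th' th; [by rewrite /th'; lra.. |].
have [||N2 H2] := @half_pow be' be; [by rewrite /be'; lra.. |].
have [||N3 H3] := @half_pow ga ga'; [by rewrite /ga'; lra.. |].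
have half0 : 0 < 1 / 2 :> R by lra.
have [m [G [m0 Nm near off]]] :=
  glue sq (exprn_gt0 k1 th0') ann (maxn N1 (maxn N2 N3)) half0.
exists (k1 * m)%N, G; rewrite muln_gt0 k10 m0.
have mk : (m <= k1 * m)%N by rewrite leq_pmull.
have [m1 m2 m3] : [/\ (N1 <= m)%N, (N2 <= m)%N & (N3 <= m)%N].
  by move: Nm; rewrite !geq_max => /and3P[].
have {}H1 := H1 _ (leq_trans m1 mk).
have {}H2 := H2 _ (leq_trans m2 mk).
have {}H3 := H3 _ (leq_trans m3 mk).
rewrite -exprM in near off; set K := (k1 * m)%N in H1 H2 H3 near off *.
have thK : 0 < th ^+ K by rewrite exprn_gt0.
have thbeK : th ^+ K <= be ^+ K by rewrite lerXn2r ?nnegrE; lra.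
have thgaK : th ^+ K <= ga ^+ K by rewrite lerXn2r ?nnegrE; lra.
have close chi (t : R) : spectrum q chi -> normc (chi h) <= 1 -> 0 <= t ->
    normc (chi G1) <= t ^+ k1 -> normc (chi G) <= t ^+ K + 1 / 2 * th ^+ K.
  move=> sc hc t0 Gt; rewrite -(subrK (chi G1 ^+ m) (chi G)) addrC.
  rewrite (le_trans (normcD_le _ _))// lerD ?near// normcX /K exprM.
  by rewrite lerXn2r ?nnegrE ?normc_ge0 ?exprn_ge0.
have [th'0 be'0] : 0 <= th' /\ 0 <= be' by rewrite /th' /be'; split; lra.
split=> //.
- move=> chi sc hyp; have [hc|hc] := leP (1 / 2) (normc (chi h)).
    by rewrite (le_trans (off _ sc hc))//; lra.
  have hc1 : normc (chi h) <= 1 by lra.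
  have sc' : spectrum p chi by apply/pP.
  have hyp' : ~~ in_cell hs chi || (normc (chi b) <= th0).
    by move: hyp; rewrite /= hc1.
  by rewrite (le_trans (close chi th' sc hc1 th'0 (out1 _ sc' hyp')))//; lra.
- move=> chi sc; have [hc|hc] := leP (1 / 2) (normc (chi h)).
    by rewrite (le_trans (off _ sc hc))//; lra.
  have hc1 : normc (chi h) <= 1 by lra.
  have sc' : spectrum p chi by apply/pP.
  by rewrite (le_trans (close chi be' sc hc1 be'0 (all1 _ sc')))//; lra.
- have n1 := near xi sxi hxi.
  have n2 : ga' ^+ K <= normc (xi G1 ^+ m).
    by rewrite /K exprM normcX lerXn2r ?nnegrE ?normc_ge0 ?exprn_ge0// /ga'; lra.
  have := normcB_ge (xi G1 ^+ m) (xi G - xi G1 ^+ m); rewrite subrKC; lra.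
Qed.

End Cells.

(** * Homogeneous polynomials on projective space *)

Section Sections.
Variables (R : realType) (n : nat).
Local Notation PP := (projective_space R n).
Local Notation V := 'rV[R[i]^o]_n.+1.
Local Notation poly := (mpoly.mpoly n.+1 R[i]).
Local Notation homog d := (@mpoly.ishomog1 n.+1 R[i] d mpoly.mdeg).
Implicit Types (v w : V) (P Q a b : poly) (d : nat).

Definition ev P v : R[i] := mpoly.meval (fun i => v 0 i) P.

Definition coordp (i : 'I_n.+1) : poly := mpoly.mpolyX R[i] (mpoly.mnm1 i).

Lemma evD v a b : ev (a + b) v = ev a v + ev b v.
Proof. exact: mpoly.mevalD. Qed.

Lemma evM v a b : ev (a * b) v = ev a v * ev b v.
Proof. exact: mpoly.mevalM. Qed.

Lemma evZ v (c : R[i]) a : ev (c *: a) v = c * ev a v.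
Proof. exact: mpoly.mevalZ. Qed.

Lemma ev1 v : ev 1 v = 1.
Proof. exact: mpoly.meval1. Qed.

Lemma ev_character v : character (ev^~ v).
Proof. by split=> *; [exact: evD|exact: evM|exact: evZ|exact: ev1]. Qed.

Lemma evX v a k : ev (a ^+ k) v = ev a v ^+ k.
Proof. exact: chX (ev_character v) _ _. Qed.

Lemma evB v a b : ev (a - b) v = ev a v - ev b v.
Proof. exact: chB (ev_character v) _ _. Qed.

Lemma ev_sum v (I : Type) (s : seq I) (p : pred I) (f : I -> poly) :
  ev (\sum_(i <- s | p i) f i) v = \sum_(i <- s | p i) ev (f i) v.
Proof. exact: raddf_sum. Qed.

Lemma ev_coordp v i : ev (coordp i) v = v 0 i.
Proof. exact: mpoly.mevalXU. Qed.

Lemma character_ev (chi : poly -> R[i]) : character chi ->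
  forall a, chi a = ev a (\row_i (chi (coordp i) : R[i]^o)).
Proof.
move=> cc a; rewrite /ev mpoly.mevalE {1}[a]mpoly.mpolyE ch_sum//.
apply: eq_bigr => m _; rewrite chZ// mpoly.mpolyXE_id; congr (_ * _).
have prodE (s : seq 'I_n.+1) (f : 'I_n.+1 -> poly) :
    chi (\prod_(i <- s) f i) = \prod_(i <- s) chi (f i).
  elim: s => [|i s IH]; first by rewrite !big_nil ch1.
  by rewrite !big_cons chM// IH.
by rewrite prodE; apply: eq_bigr => i _; rewrite chX// mxE.
Qed.

Lemma ev_homogZ d P v (c : R[i]) : P \is homog d -> ev P (c *: v) = c ^+ d * ev P v.
Proof.
move=> hP; rewrite /ev -(meval_homogZ _ _ hP).
by apply: mpoly.meval_eq => i; rewrite mxE.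
Qed.

Lemma homog_coordp i : coordp i \is homog 1%N.
Proof. by rewrite mpoly.dhomogX; apply/eqP; exact: mpoly.mdeg1. Qed.

Lemma homogM d e P Q : P \is homog d -> Q \is homog e -> P * Q \is homog (d + e)%N.
Proof. exact: mpoly.dhomogM. Qed.

Lemma homogX d k P : P \is homog d -> P ^+ k \is homog (d * k)%N.
Proof. exact: mpoly.dhomogMn. Qed.

Lemma hnorm_ge_coord v i : normc (v 0 i) <= hnorm v.
Proof.
rewrite -(ger0_norm (normc_ge0 (v 0 i))) -sqrtr_sqr ler_sqrt ?sumr_ge0//; last first.
  by move=> j _; exact: sqr_ge0.
by rewrite (bigD1 i)//= lerDl sumr_ge0// => j _; exact: sqr_ge0.
Qed.

Lemma hnorm_ge0 v : 0 <= hnorm v.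
Proof. exact: sqrtr_ge0. Qed.

Lemma hnorm_gt0 v : v != 0 -> 0 < hnorm v.
Proof.
move=> /rV0Pn[i vi]; apply: lt_le_trans (hnorm_ge_coord v i).
by rewrite normc_gt0.
Qed.

Lemma ev_bounded d P : P \is homog d ->
  exists2 B, 0 <= B & forall v, normc (ev P v) <= B * hnorm v ^+ d.
Proof.
move=> /mpoly.dhomogP hP.
exists (\sum_(m <- mpoly.msupp P) normc (mpoly.mcoeff m P)) => [|v].
  by apply: sumr_ge0 => m _; exact: normc_ge0.
rewrite /ev mpoly.mevalE (le_trans (normc_sum _ _ _))// mulr_suml.
rewrite !big_seq; apply: ler_sum => m Pm; rewrite normcM ler_wpM2l ?normc_ge0//.
have -> : d = (\sum_i m i)%N by rewrite -mpoly.mdegE (hP m Pm).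
rewrite expr_sum; elim/big_ind2 : _ => [|x x' y y' xx yy|i _]; first by rewrite normc1.
  by rewrite normcM ler_pM ?normc_ge0.
by rewrite normcX lerXn2r ?nnegrE ?normc_ge0 ?hnorm_ge0 ?hnorm_ge_coord.
Qed.

(** A set of vectors, and not of elements of the subtype of nonzero vectors, so that
    vectors can be normalized freely. *)
Definition cone (K : set PP) : set V :=
  [set v | exists2 z : nonzero_vec R n, vec z = v & K (\pi_PP z)].

Lemma vec_neq0 (z : nonzero_vec R n) : vec z != 0.
Proof. by case: z => v v0; exact: set_mem v0. Qed.

Lemma vec_ex v : v != 0 -> exists z : nonzero_vec R n, vec z = v.
Proof. by move=> v0; exists (exist _ v (mem_set v0)). Qed.

Lemma cone_neq0 (K : set PP) v : cone K v -> v != 0.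
Proof. by move=> [z <- _]; exact: vec_neq0. Qed.

Lemma pi_eq (z w : nonzero_vec R n) (c : R[i]) : vec z = c *: vec w ->
  \pi_PP z = \pi_PP w.
Proof.
move=> zw; have c0 : c != 0.
  by apply: contraNneq (vec_neq0 z) => c0; rewrite zw c0 scale0r.
have zw' : collinear z w by apply/asboolP; exact: (ex_intro2 _ _ c c0 zw).
have : z = w %[mod {eq_quot (collinear_equiv R n)}] by exact/eqmodP.
exact.
Qed.

Lemma cone_pi (K : set PP) (z : nonzero_vec R n) : cone K (vec z) <-> K (\pi_PP z).
Proof.
split=> [[w wz Kw]|Kz]; last by exists z.
by have <- : \pi_PP w = \pi_PP z by apply: (@pi_eq w z 1); rewrite scale1r.
Qed.

Lemma coneZ (K : set PP) v (c : R[i]) : c != 0 -> cone K v -> cone K (c *: v).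
Proof.
move=> c0 [z <- Kz]; have [w wz] : exists w : nonzero_vec R n, vec w = c *: vec z.
  by apply: vec_ex; rewrite scaler_eq0 (negbTE c0) vec_neq0.
by exists w => //; rewrite (pi_eq wz).
Qed.

Lemma cone_repr (K : set PP) (y : PP) : K y <-> cone K (vec (repr y)).
Proof. by rewrite cone_pi reprK. Qed.

Section SupNorm.
Variable K : set PP.
Local Notation S d P := (sup_norm d P K).

Lemma section_norm_ge0 d P (x : PP) : 0 <= section_norm d P x.
Proof. by rewrite divr_ge0 ?normc_ge0// exprn_ge0// hnorm_ge0. Qed.

Let sup_norm_empty d P : ~ (exists y, K y) -> S d P = 0.
Proof.
move=> K0; have E : K = set0 by rewrite -subset0 => y Ky; apply: K0; exists y.
by rewrite /sup_norm E image_set0 sup0.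
Qed.

Lemma sup_norm_ge d P v : P \is homog d -> cone K v ->
  normc (ev P v) <= S d P * hnorm v ^+ d.
Proof.
move=> hP [z <- Kz]; rewrite -ler_pdivrMr ?exprn_gt0 ?hnorm_gt0 ?vec_neq0//.
rewrite -/(ev _ _) -(section_norm_pi z hP); apply: ub_le_sup; last by exists (\pi_PP z).
have [B B0 HB] := ev_bounded hP; exists B => _ [y _ <-].
by rewrite ler_pdivrMr ?exprn_gt0 ?hnorm_gt0 ?vec_neq0// HB.
Qed.

Lemma sup_norm_le d P B : 0 <= B ->
  (forall v, cone K v -> normc (ev P v) <= B * hnorm v ^+ d) -> S d P <= B.
Proof.
move=> B0 HB; have [[y Ky]|K0] := pselect (exists y, K y); last first.
  by rewrite sup_norm_empty.
apply: ge_sup; first by exists (section_norm d P y), y.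
move=> _ [x Kx <-]; rewrite ler_pdivrMr ?exprn_gt0 ?hnorm_gt0 ?vec_neq0// HB//.
exact/cone_repr.
Qed.

Lemma sup_norm_ge0 d P : 0 <= S d P.
Proof.
have [[y Ky]|K0] := pselect (exists y, K y); last first.
  by rewrite sup_norm_empty.
have [hs|hs] := pselect (has_sup [set section_norm d P x | x in K]).
  by rewrite (le_trans (section_norm_ge0 d P y))// ub_le_sup; [|case: hs|exists y].
by rewrite /sup_norm sup_out.
Qed.

Lemma sup_normM d e P Q : P \is homog d -> Q \is homog e ->
  S (d + e)%N (P * Q) <= S d P * S e Q.
Proof.
move=> hP hQ; apply: sup_norm_le => [|v Kv]; first by rewrite mulr_ge0 ?sup_norm_ge0.
rewrite evM normcM exprD mulrACA ler_pM ?normc_ge0 ?sup_norm_ge//.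
Qed.

Lemma sup_normZ d P c : P \is homog d -> S d (c *: P) <= normc c * S d P.
Proof.
move=> hP; apply: sup_norm_le => [|v Kv]; first by rewrite mulr_ge0 ?normc_ge0 ?sup_norm_ge0.
by rewrite evZ normcM -mulrA ler_wpM2l ?normc_ge0 ?sup_norm_ge.
Qed.

Lemma sup_norm1 : S 0 1 <= 1.
Proof. by apply: sup_norm_le => // v _; rewrite ev1 normc1 expr0 mulr1. Qed.

End SupNorm.
End Sections.

(** * Seminorms whose spectrum is in the projective hull *)

Section HullSeminorm.
Variables (R : realType) (n : nat) (K : set (projective_space R n)).
Local Notation PP := (projective_space R n).
Local Notation V := 'rV[R[i]^o]_n.+1.
Local Notation poly := (mpoly.mpoly n.+1 R[i]).
Local Notation homog d := (@mpoly.ishomog1 n.+1 R[i] d mpoly.mdeg).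
Local Notation S d P := (sup_norm d P K).
Implicit Types (v w : V) (P Q a b : poly) (d : nat) (l : seq (nat * poly)).

(** A vector [v] is in the polynomial hull of the vectors of norm [tau] over [K];
    homogeneous polynomials suffice to test this. *)
Definition dominated (tau : R) v : Prop :=
  forall d P, P \is homog d -> normc (ev P v) <= tau ^+ d * S d P.

Lemma dominated_hull tau v : 0 < tau -> v != 0 -> dominated tau v ->
  cone (projective_hull K) v.
Proof.
move=> t0 v0 H; have [z zv] := vec_ex v0; exists z => //.
have h0 := hnorm_gt0 v0; exists (tau / hnorm v) => [|d P d0 hP]; first exact: divr_gt0.
rewrite section_norm_pi// zv expr_div_n mulrAC ler_pM2r ?invr_gt0 ?exprn_gt0//.
exact: H.
Qed.

Lemma hull_dominated v : cone (projective_hull K) v ->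
  exists2 tau, 0 < tau & dominated tau v.
Proof.
move=> Kv; have v0 := cone_neq0 Kv; have [z zv [C C0 HC]] := Kv.
have h0 := hnorm_gt0 v0.
have H d P : (0 < d)%N -> P \is homog d ->
    normc (ev P v) <= (C * hnorm v) ^+ d * S d P.
  move=> d0 hP; have := HC d P d0 hP; rewrite section_norm_pi// zv.
  by rewrite ler_pdivrMr ?exprn_gt0// exprMn mulrAC.
have [y Ky] : exists y, K y.
  apply: contrapT => K0; have /rV0Pn[i vi] := v0.
  have S0 : S 1 (coordp R i) = 0.
    apply/le_anti; rewrite sup_norm_ge0 andbT; apply: sup_norm_le => // w [y _ Ky].
    by case: K0; exists (\pi_PP y).
  have := H 1%N (coordp R i) isT (homog_coordp _ _); rewrite S0 mulr0 ev_coordp.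
  by rewrite leNgt normc_gt0 vi.
exists (C * hnorm v); first exact: mulr_gt0.
move=> [|d] P hP; last exact: H.
have E w : ev P w = ev P 0.
  by have := ev_homogZ w 0 hP; rewrite scale0r expr0 mul1r.
have /cone_repr Kw := Ky.
by have := sup_norm_ge hP Kw; rewrite !expr0 mulr1 mul1r !E.
Qed.

Variables (i0 : 'I_n.+1).

Section Tau.
Variables (tau : R) (tau0 : 0 < tau).

(** Only values in the affine chart [v i0 = 1] are compared, so that summands of
    different degrees are allowed; each has the norm of the section it defines. *)
Definition chart_presented a (t : R) : Prop := exists l,
  [/\ all (fun x => x.2 \is homog x.1) l,
    forall v, v 0 i0 = 1 -> ev a v = \sum_(x <- l) ev x.2 v
    & \sum_(x <- l) tau ^+ x.1 * S x.1 x.2 <= t].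

Definition chart_sn : poly -> R := gauge chart_presented.

Let cost_ge0 l : 0 <= \sum_(x <- l) tau ^+ x.1 * S x.1 x.2.
Proof.
by apply: sumr_ge0 => x _; rewrite mulr_ge0 ?exprn_ge0 ?sup_norm_ge0// ltW.
Qed.

Lemma chart_presented_ge0 a t : chart_presented a t -> 0 <= t.
Proof. by move=> [l [_ _]]; apply: le_trans. Qed.

Lemma chart_presented_homog d P : P \is homog d ->
  chart_presented P (tau ^+ d * S d P).
Proof.
move=> hP; exists [:: (d, P)]; rewrite /= hP; split=> // [v _|].
  by rewrite big_cons big_nil addr0.
by rewrite big_cons big_nil addr0.
Qed.

Lemma chart_presented_ex a : exists t, chart_presented a t.
Proof.
pose l := [seq (mpoly.mdeg m, mpoly.mcoeff m a *: mpoly.mpolyX R[i] m) | m <- mpoly.msupp a].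
exists (\sum_(x <- l) tau ^+ x.1 * S x.1 x.2), l; split=> //.
  rewrite all_map; apply/allP => m _ /=.
  by apply: mpoly.dhomogZ; rewrite mpoly.dhomogX.
by move=> v _; rewrite big_map -ev_sum -mpoly.mpolyE.
Qed.

Lemma chart_seminorm : seminorm chart_sn.
Proof.
apply: gauge_seminorm.
- exact: chart_presented_ge0.
- exact: chart_presented_ex.
- move=> a b t u [l [hl al lt]] [l' [hl' bl' lu]]; exists (l ++ l').
  rewrite all_cat hl hl' big_cat lerD//; split=> // v v1.
  by rewrite big_cat evD al// bl'.
- move=> a b t u [l [hl al lt]] [l' [hl' bl' lu]].
  exists [seq ((x.1 + y.1)%N, x.2 * y.2) | x : nat * poly <- l, y : nat * poly <- l'].
  split.
  + apply/allP => _ /allpairsP[[x y] [/= xl yl ->]] /=.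
    by apply: homogM; [exact: (allP hl)|exact: (allP hl')].
  + move=> v v1; rewrite evM al// bl'// big_allpairs_dep mulr_suml.
    apply: eq_bigr => x _; rewrite mulr_sumr; apply: eq_bigr => y _.
    by rewrite evM.
  + apply: le_trans (ler_pM (cost_ge0 l) (cost_ge0 l') lt lu).
    rewrite big_allpairs_dep mulr_suml !big_seq; apply: ler_sum => x xl.
    rewrite mulr_sumr !big_seq; apply: ler_sum => y yl.
    rewrite /= exprD mulrACA ler_wpM2l ?mulr_ge0 ?exprn_ge0 ?(ltW tau0)//.
    by apply: sup_normM; [exact: (allP hl)|exact: (allP hl')].
- move=> c a t [l [hl al lt]]; exists [seq (x.1, c *: x.2) | x : nat * poly <- l].
  split.
  + by rewrite all_map; apply: sub_all hl => x /= hx; exact: mpoly.dhomogZ.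
  + move=> v v1; rewrite evZ al// big_map mulr_sumr.
    by apply: eq_bigr => x _; rewrite evZ.
  + apply: le_trans (ler_wpM2l (normc_ge0 c) lt).
    rewrite big_map mulr_sumr !big_seq; apply: ler_sum => x xl /=.
    by rewrite mulrCA ler_wpM2l ?exprn_ge0 ?(ltW tau0)// sup_normZ// (allP hl).
- exists [:: (0%N, 1)]; rewrite /= mpoly.dhomog1; split=> // [v _|].
    by rewrite big_cons big_nil addr0.
  by rewrite big_cons big_nil addr0 /= expr0 mul1r sup_norm1.
Qed.

(** Characters are points because polynomials in the coordinates are all there is;
    the presentation of [Z_i0 - 1] by the empty sum puts them in the chart. *)
Lemma chart_spectrumP (chi : poly -> R[i]) : spectrum chart_sn chi ->
  exists v, [/\ v 0 i0 = 1, forall a, chi a = ev a v & dominated tau v].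
Proof.
move=> [cc cq]; pose v : V := \row_i chi (coordp R i).
have chiE a : chi a = ev a v := character_ev cc a.
exists v; split=> // [|d P hP].
  apply/eqP; rewrite mxE -subr_eq0 -(ch1 cc) -chB// -normc0_eq0.
  apply/eqP/le_anti; rewrite normc_ge0 andbT (le_trans (cq _))// gauge_le//.
    exact: chart_presented_ge0.
  exists [::]; split=> // [w w1|]; last by rewrite big_nil.
  by rewrite big_nil evB ev1 ev_coordp w1 subrr.
rewrite -chiE (le_trans (cq _))// gauge_le//; first exact: chart_presented_ge0.
exact: chart_presented_homog.
Qed.

Lemma dominated_spectrum v : v 0 i0 = 1 -> dominated tau v ->
  spectrum chart_sn (fun a => ev a v).
Proof.
move=> v1 dv; split=> [|a]; first exact: ev_character.
apply: gauge_ge => [b|t [l [hl al lt]]]; first exact: chart_presented_ex.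
apply: le_trans lt; rewrite al// (le_trans (normc_sum _ _ _))// !big_seq.
by apply: ler_sum => x xl; apply: dv; exact: (allP hl).
Qed.

End Tau.

Lemma cone_dominated tau v : 0 < tau -> v 0 i0 = 1 -> cone K v ->
  hnorm v <= tau -> dominated tau v.
Proof.
move=> t0 v1 Kv vt d P hP; rewrite (le_trans (sup_norm_ge hP Kv))// mulrC.
by rewrite ler_wpM2r ?sup_norm_ge0// lerXn2r ?nnegrE ?hnorm_ge0// ltW.
Qed.

End HullSeminorm.

(** * The local maximum principle *)

Section FinalEstimate.
Variables (R : realType) (n : nat) (K : set (projective_space R n)) (i0 : 'I_n.+1).
Local Notation V := 'rV[R[i]^o]_n.+1.
Local Notation poly := (mpoly.mpoly n.+1 R[i]).
Local Notation homog d := (@mpoly.ishomog1 n.+1 R[i] d mpoly.mdeg).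
Local Notation S d P := (sup_norm d P K).
Implicit Types (v xi : V).

(** The homogenization in degree [D] of the part of degree at most [D] of a sum of
    homogeneous polynomials. *)
Let truncate D (l : seq (nat * poly)) : poly :=
  \sum_(x <- l | (x.1 <= D)%N) coordp R i0 ^+ (D - x.1) * x.2.

Let truncate_homog D l : all (fun x => x.2 \is homog x.1) l -> truncate D l \is homog D.
Proof.
move=> /allP hl; rewrite /truncate big_seq_cond; apply: rpred_sum => x /andP[xl xD].
have := homogM (homogX (D - x.1) (homog_coordp R i0)) (hl x xl).
by rewrite mul1n subnK.
Qed.

Let ev_truncate D l v :
  ev (truncate D l) v = \sum_(x <- l | (x.1 <= D)%N) v 0 i0 ^+ (D - x.1) * ev x.2 v.
Proof. by rewrite ev_sum; apply: eq_bigr => x _; rewrite evM evX ev_coordp. Qed.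

Section Truncation.
Variables (D : nat) (tau c theta : R) (F : poly) (l : seq (nat * poly)).
Hypotheses (tau0 : 0 < tau) (c0 : 0 <= c) (theta0 : 0 <= theta)
  (hl : all (fun x => x.2 \is homog x.1) l)
  (Fl : forall v : V, v 0 i0 = 1 -> ev F v = \sum_(x <- l) ev x.2 v)
  (cost : \sum_(x <- l) tau ^+ x.1 * S x.1 x.2 <= c ^+ D).

Let tail_bound (t : R) (f : nat * poly -> R) : 0 <= t ->
  (forall x, x \in l -> (D < x.1)%N -> f x <= t * (tau ^+ x.1 * S x.1 x.2)) ->
  \sum_(x <- l | ~~ (x.1 <= D)%N) f x <= t * c ^+ D.
Proof.
move=> t0 H; rewrite (le_trans _ (ler_wpM2l t0 cost))// mulr_sumr.
rewrite [leRHS](bigID (fun x => ~~ (x.1 <= D)%N))/= -[leLHS]addr0 lerD//.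
  rewrite [leLHS]big_seq_cond [leRHS]big_seq_cond.
  by apply: ler_sum => x /andP[xl xD]; apply: H => //; rewrite ltnNge.
apply: sumr_ge0 => x _.
by rewrite !mulr_ge0 ?exprn_ge0 ?sup_norm_ge0// ltW.
Qed.

Let head_bound (t : R) (f : nat * poly -> R) : 0 <= t ->
  (forall x, x \in l -> (x.1 <= D)%N -> f x <= t * (tau ^+ x.1 * S x.1 x.2)) ->
  \sum_(x <- l | (x.1 <= D)%N) f x <= t * c ^+ D.
Proof.
move=> t0 H; rewrite (le_trans _ (ler_wpM2l t0 cost))// mulr_sumr.
rewrite [leRHS](bigID (fun x => (x.1 <= D)%N))/= -[leLHS]addr0 lerD//.
  rewrite [leLHS]big_seq_cond [leRHS]big_seq_cond.
  by apply: ler_sum => x /andP[xl xD]; apply: H.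
apply: sumr_ge0 => x _.
by rewrite !mulr_ge0 ?exprn_ge0 ?sup_norm_ge0// ltW.
Qed.

Let ev_truncate_chart v : v 0 i0 = 1 ->
  ev (truncate D l) v = ev F v - \sum_(x <- l | ~~ (x.1 <= D)%N) ev x.2 v.
Proof.
move=> v1; rewrite ev_truncate Fl// [in RHS](bigID (fun x => (x.1 <= D)%N))/= addrK.
by apply: eq_bigr => x _; rewrite v1 expr1n mul1r.
Qed.

(** Near the hyperplane at infinity of the chart the terms of low degree are
    damped by the powers of the coordinate; elsewhere on [K] the truncation agrees
    with [F] up to the terms of high degree. *)
Let sup_norm_truncate :
  (forall v, v 0 i0 = 1 -> cone K v -> hnorm v <= tau -> normc (ev F v) <= theta ^+ D) ->
  S D (truncate D l) <= theta ^+ D + (c / tau) ^+ D.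
Proof.
move=> HF; have ctau : 0 <= c / tau by rewrite divr_ge0// ltW.
apply: sup_norm_le => [|z Kz]; first by rewrite addr_ge0// exprn_ge0.
have z0 := hnorm_gt0 (cone_neq0 Kz); set N := hnorm z in z0 *.
set r := normc (z 0 i0); have r0 : 0 <= r := normc_ge0 _.
have [small|big] := leP (r * tau) N.
  rewrite ev_truncate (le_trans (normc_sum _ _ _))// mulrDl.
  have -> : (c / tau) ^+ D * N ^+ D = ((N / tau) ^+ D) * c ^+ D.
    by rewrite !expr_div_n mulrAC [RHS]mulrC mulrA.
  rewrite -[leLHS]add0r lerD ?mulr_ge0 ?exprn_ge0 ?(ltW z0)//.
  have Nt : 0 <= N / tau by rewrite divr_ge0 ?ltW.
  apply: head_bound => [|x xl xD]; first exact: exprn_ge0.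
  rewrite normcM normcX -/r; have rN : r <= N / tau by rewrite ler_pdivlMr.
  have hx : x.2 \is homog x.1 := allP hl x xl.
  have := ler_pM (exprn_ge0 (D - x.1) r0) (normc_ge0 _) (lerXn2r (D - x.1) r0 Nt rN)
    (sup_norm_ge hx Kz).
  move=> /le_trans; apply; rewrite -/N -[in X in _ <= X](subnK xD) exprD.
  rewrite le_eqVlt; apply/orP; left; apply/eqP.
  by rewrite [(N / tau) ^+ x.1]expr_div_n; field; rewrite expf_neq0// gt_eqF.
have rp : 0 < r by rewrite -(pmulr_rgt0 _ tau0) mulrC (lt_trans z0).
have zi0 : z 0 i0 != 0 by rewrite -normc0_eq0 gt_eqF.
pose v := (z 0 i0)^-1 *: z.
have v1 : v 0 i0 = 1 by rewrite mxE mulVf.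
have Kv : cone K v by apply: coneZ => //; rewrite invr_eq0.
have zv : z = z 0 i0 *: v by rewrite scalerA mulfV// scale1r.
pose u := hnorm v; have Nru : N = r * u by rewrite /N zv hnormZ.
have ut : u <= tau by rewrite -(ler_pM2l rp) -Nru ltW.
have u1 : 1 <= u by have := hnorm_ge_coord v i0; rewrite v1 normc1.
rewrite {1}zv (ev_homogZ _ _ (truncate_homog D hl)) normcM normcX -/r Nru [(r * u) ^+ _]exprMn.
rewrite [leRHS]mulrCA ler_wpM2l ?exprn_ge0// ev_truncate_chart//.
rewrite (le_trans (normcD_le _ _))// normcN_eq mulrDl lerD//.
  by rewrite (le_trans (HF v v1 Kv ut))// ler_peMr ?exprn_ge0 ?exprn_ege1.
rewrite (le_trans (normc_sum _ _ _))//.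
have -> : (c / tau) ^+ D * u ^+ D = (u / tau) ^+ D * c ^+ D.
  by rewrite !expr_div_n mulrAC [RHS]mulrC mulrA.
have u_tau : 0 <= u / tau by rewrite divr_ge0 ?(ltW tau0)//; lra.
apply: tail_bound => [|x xl xD]; first exact: exprn_ge0.
have hx : x.2 \is homog x.1 := allP hl x xl.
rewrite (le_trans (sup_norm_ge hx Kv))// -/u mulrC mulrA ler_wpM2r ?sup_norm_ge0//.
rewrite -{1}(divfK (lt0r_neq0 tau0) u) exprMn ler_wpM2r ?exprn_ge0 ?(ltW tau0)//.
by rewrite ler_wiXn2l ?(ltnW xD)// ler_pdivrMr// mul1r.
Qed.

(** The truncation is a homogeneous polynomial of degree [D], so its value at [xi] is
    controlled by its norm on [K]. *)
Lemma truncation_inequality xi t0 : xi 0 i0 = 1 -> 0 < t0 -> t0 <= tau ->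
  dominated K t0 xi ->
  (forall v, v 0 i0 = 1 -> cone K v -> hnorm v <= tau -> normc (ev F v) <= theta ^+ D) ->
  normc (ev F xi) <= (t0 * theta) ^+ D + 2 * (t0 * c / tau) ^+ D.
Proof.
move=> xi1 t00 t0t dxi HF.
have ED : (t0 * c / tau) ^+ D = (t0 / tau) ^+ D * c ^+ D.
  by rewrite -exprMn; congr (_ ^+ _); rewrite mulrAC.
have tt : 0 <= t0 / tau by rewrite divr_ge0 ?ltW.
have tail : normc (\sum_(x <- l | ~~ (x.1 <= D)%N) ev x.2 xi) <= (t0 * c / tau) ^+ D.
  rewrite (le_trans (normc_sum _ _ _))// ED.
  apply: tail_bound => [|x xl xD]; first exact: exprn_ge0.
  have hx : x.2 \is homog x.1 := allP hl x xl.
  rewrite (le_trans (dxi _ _ hx))// mulrA ler_wpM2r ?sup_norm_ge0//.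
  rewrite -{1}(divfK (lt0r_neq0 tau0) t0) exprMn ler_wpM2r ?exprn_ge0 ?(ltW tau0)//.
  by rewrite ler_wiXn2l ?(ltnW xD)// ler_pdivrMr// mul1r.
have head : normc (ev (truncate D l) xi) <= (t0 * theta) ^+ D + (t0 * c / tau) ^+ D.
  rewrite (le_trans (dxi _ _ (truncate_homog D hl)))//.
  rewrite (le_trans (ler_wpM2l (exprn_ge0 D (ltW t00)) (sup_norm_truncate HF)))//.
  by rewrite mulrDr -!exprMn mulrA.
have E : ev F xi = ev (truncate D l) xi + \sum_(x <- l | ~~ (x.1 <= D)%N) ev x.2 xi.
  by rewrite ev_truncate_chart// subrK.
by rewrite E (le_trans (normcD_le _ _))//; lra.
Qed.

End Truncation.

(** If [G] grows at most like [be ^ k] on the whole spectrum, the powers of [G] have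
    presentations of cost [be1 ^ D], and truncating them at the degree [D]
    contradicts the domination of [xi]. *)
Lemma growth_contradiction (G : poly) k tau be be1 th ga t0 xi :
  (0 < k)%N -> xi 0 i0 = 1 -> 0 < t0 -> t0 <= tau -> dominated K t0 xi ->
  0 <= be -> be < be1 -> 0 <= th -> 0 < ga ->
  (forall chi, spectrum (chart_sn K i0 tau) chi -> normc (chi G) <= be ^+ k) ->
  (forall v, v 0 i0 = 1 -> cone K v -> hnorm v <= tau -> normc (ev G v) <= th ^+ k) ->
  ga ^+ k <= normc (ev G xi) ->
  t0 * th <= ga / 4 -> t0 * be1 / tau <= ga / 4 -> False.
Proof.
move=> k0 xi1 t00 t0t dxi be0 bebe1 th0 ga0 all_be K_th xi_ga h1 h2.
have tau0 : 0 < tau by exact: lt_le_trans t0t.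
have be10 : 0 < be1 by exact: le_lt_trans bebe1.
have sn := chart_seminorm K i0 tau0.
have bb : bounded_below 1 0 (chart_sn K i0 tau) by move=> a; rewrite mul0r (sn_ge0 sn).
have [chi sc _|m m0 H] := spectral_radius_lt (a := G) sn (lexx 0) bb (exprn_gt0 k be10).
  by rewrite (le_lt_trans (all_be _ sc))// ltrXn2r// -lt0n.
have [j /(_ j.+1 (leqnSn j))] := H 1 ltr01; rewrite mul1r -exprM.
set N := (m * j.+1)%N => lt.
have N0 : (0 < N)%N by rewrite muln_gt0 m0.
have [v [l [hl Fl lv]] vlt] := gauge_lt (@chart_presented_ge0 _ _ K i0 _ tau0)
  (@chart_presented_ex _ _ K i0 tau) lt.
have cost := le_trans lv (ltW vlt).
have D0 : (0 < k * N)%N by rewrite muln_gt0 k0.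
have := truncation_inequality tau0 (ltW be10) th0 hl Fl cost xi1 t00 t0t dxi.
rewrite evX normcX => /(_ _)/wrap[].
  move=> w w1 Kw wt; rewrite evX normcX exprM lerXn2r ?nnegrE ?normc_ge0 ?exprn_ge0//.
  exact: K_th.
apply/negP; rewrite -ltNge.
have e1 : (t0 * th) ^+ (k * N) <= (ga / 4) ^+ (k * N).
  by rewrite lerXn2r ?nnegrE//; [rewrite mulr_ge0// ltW | lra].
have e2 : (t0 * be1 / tau) ^+ (k * N) <= (ga / 4) ^+ (k * N).
  by rewrite lerXn2r ?nnegrE//; [rewrite !mulr_ge0 ?invr_ge0// ltW | lra].
have e3 : (ga / 4) ^+ (k * N) <= ga ^+ (k * N) / 4.
  rewrite expr_div_n ler_wpM2l ?exprn_ge0 ?(ltW ga0)// lef_pV2 ?posrE ?exprn_gt0//.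
  by rewrite -[leLHS]expr1 ler_weXn2l//; lra.
have e4 : ga ^+ (k * N) <= normc (ev G xi) ^+ N.
  by rewrite exprM lerXn2r ?nnegrE ?exprn_ge0 ?normc_ge0// ltW.
have e5 : 0 < ga ^+ (k * N) by rewrite exprn_gt0.
lra.
Qed.

End FinalEstimate.

Section LocalMaximum.
Variables (R : realType) (n : nat) (K : set (projective_space R n)) (i0 : 'I_n.+1).
Local Notation V := 'rV[R[i]^o]_n.+1.
Local Notation poly := (mpoly.mpoly n.+1 R[i]).
Local Notation hull := (projective_hull K).
Implicit Types (v xi : V) (u : poly).

Let half_div (a t : R) : a / (2 * t) = (a / 2) / t.
Proof. by rewrite invfM mulrA. Qed.

Let constants_exist (t0 delta eps x : R) : 1 <= t0 -> 0 < eps -> 0 < x -> 0 < delta ->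
  32 * t0 * x <= eps -> exists th be0 be1 ga tau,
  [/\ 3 / (2 * eps) < th, th <= be0, 2 / delta <= be0, be0 < be1 &
  [/\ th <= ga, 0 < ga, ga < 1 / (2 * x), t0 * th <= ga / 4 &
  t0 <= tau /\ t0 * be1 / tau <= ga / 4]].
Proof.
move=> t01 e0 x0 d0 small; have t00 : 0 < t0 by lra.
pose th := 2 / eps; pose be0 := Num.max (2 / delta) th.
pose ga := 1 / (4 * x); pose tau := Num.max t0 (4 * t0 * (be0 + 1) / ga).
exists th, be0, (be0 + 1), ga, tau.
have ga_gt0 : 0 < ga by rewrite divr_gt0// mulr_gt0.
have th_gt0 : 0 < th by rewrite divr_gt0.
have t0th : t0 * th <= ga / 4.
  have -> : ga / 4 = (1 / 16) / x by rewrite /ga; field; lra.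
  by rewrite ler_pdivlMr// /th mulrA mulrAC ler_pdivrMr//; lra.
have thga : th <= ga.
  by have : 0 <= (t0 - 1) * th; [rewrite mulr_ge0//; lra | lra].
have t0tau : t0 <= tau by rewrite /tau le_max lexx.
have tau0 : 0 < tau by exact: lt_le_trans t0tau.
split; rewrite ?ltrDl// /be0 ?le_max ?lexx ?orbT//.
  have -> : th = 3 / (2 * eps) + 1 / (2 * eps) by rewrite /th; field; lra.
  by rewrite ltrDl divr_gt0// mulr_gt0.
split=> //.
  have -> : 1 / (2 * x) = ga + ga by rewrite /ga; field; lra.
  by rewrite ltrDl.
split=> //; have : 4 * t0 * (be0 + 1) / ga <= tau by rewrite /tau le_max lexx orbT.
by rewrite -/be0 ler_pdivrMr// => h; rewrite ler_pdivrMr//; lra.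
Qed.

Definition eval_at v : poly -> R[i] := fun a => ev a v.

Lemma dominatedW t0 t1 v : 0 < t0 -> t0 <= t1 -> dominated K t0 v -> dominated K t1 v.
Proof.
move=> t00 t01 dv d P hP; rewrite (le_trans (dv d P hP))// ler_wpM2r ?sup_norm_ge0//.
by rewrite lerXn2r ?nnegrE ?(ltW t00) ?(ltW (lt_le_trans t00 t01)).
Qed.

(** The local maximum principle for [1 / u]: on the part of the hull in a cell that
    is disjoint from [K] and where [u] has no zeros, [1 / u] cannot be much larger
    at a point than on the shell of the cell. For otherwise powers of an approximate
    inverse of [u], extended by [local_extension], would have a small norm on [K]
    relative to their values at [xi]. *)
Theorem local_maximum hs u xi (t0 delta eps : R) :
  xi 0 i0 = 1 -> 1 <= t0 -> dominated K t0 xi -> in_cell hs (eval_at xi) ->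
  0 < delta -> 0 < eps ->
  (forall v, v 0 i0 = 1 -> cone K v -> ~~ in_cell hs (eval_at v)) ->
  (forall v, v 0 i0 = 1 -> cone hull v -> in_cell hs (eval_at v) ->
    delta <= normc (ev u v)) ->
  (forall v, v 0 i0 = 1 -> cone hull v -> in_cell hs (eval_at v) ->
    in_shell hs (eval_at v) -> eps <= normc (ev u v)) ->
  eps < 32 * t0 * normc (ev u xi).
Proof.
move=> xi1 t01 dxi cxi d0 e0 HK Hd He; rewrite ltNge; apply/negP => small.
have t00 : 0 < t0 by lra.
have neq0 v : v 0 i0 = 1 -> v != 0.
  by move=> v1; apply/eqP => v0; move: v1; rewrite v0 mxE => /esym/eqP; rewrite oner_eq0.
have hxi : cone hull xi by apply: dominated_hull (neq0 _ xi1) dxi.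
set x := normc (ev u xi) in small.
have x0 : 0 < x by rewrite (lt_le_trans d0)// Hd.
have [th [be0 [be1 [ga [tau [thth thbe dbe bebe1 [thga ga_gt0 gaga t0th [t0tau taube]]]]]]]] :=
  constants_exist t01 e0 x0 d0 small.
have th00 : 0 < 3 / (2 * eps) by rewrite divr_gt0// mulr_gt0.
have th_gt0 : 0 < th := lt_trans th00 thth.
have tau0 : 0 < tau by exact: lt_le_trans t0tau.
pose q := chart_sn K i0 tau; have sq : seminorm q := chart_seminorm K i0 tau0.
have specP chi : spectrum q chi -> exists v, [/\ v 0 i0 = 1, chi = eval_at v & cone hull v].
  move=> /(chart_spectrumP tau0)[v [v1 chiv dv]]; exists v; split=> //.
    by apply/funext => a; rewrite chiv.
  exact: dominated_hull (neq0 _ v1) dv.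
have sxi : spectrum q (eval_at xi).
  by apply: dominated_spectrum => //; exact: dominatedW dxi.
have [|b Hb] := approx_inverse (hs := hs) (u := u) sq.
  move=> chi /specP[v [v1 -> hv]] ic; rewrite -normc0_eq0 gt_eqF//.
  by rewrite (lt_le_trans d0)// Hd.
have b_ub (t : R) v : spectrum q (eval_at v) -> in_cell hs (eval_at v) -> 0 < t ->
    t <= normc (ev u v) -> normc (ev b v) <= 3 / (2 * t).
  move=> sv ic tp tu; have := Hb _ sv ic; rewrite /eval_at => Hbv.
  have := normcB_ge (ev b v * ev u v) (1 - ev b v * ev u v).
  rewrite subrKC normc1 normcM => h.
  have h2 : normc (ev b v) * t <= normc (ev b v) * normc (ev u v).
    by rewrite ler_wpM2l ?normc_ge0.
  rewrite half_div.
  by rewrite ler_pdivlMr//; lra.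
have xib : 1 / (2 * x) <= normc (ev b xi).
  have := Hb _ sxi cxi; rewrite /eval_at => Hbv.
  have := normcD_le (ev b xi * ev u xi) (1 - ev b xi * ev u xi).
  rewrite subrKC normc1 normcM => h.
  rewrite half_div.
  by rewrite ler_pdivrMr// /x; lra.
have [|||k [G [k0 G_off G_all G_xi]]] := local_extension (b := b) (be := (be0 + be1) / 2) sq sxi cxi
    (ltW th00) thth thbe _ thga gaga xib.
- lra.
- move=> chi sc ic; have [v [v1 E hv]] := specP _ sc; rewrite E in sc ic *.
  rewrite (le_trans (b_ub delta v sc ic d0 (Hd v v1 hv ic)))// (le_trans _ dbe)//.
  by rewrite half_div ler_pM2r ?invr_gt0//; lra.
- move=> chi sc ic ish; have [v [v1 E hv]] := specP _ sc; rewrite E in sc ic ish *.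
  exact: b_ub (He v v1 hv ic ish).
apply: (growth_contradiction (be1 := be1) k0 xi1 t00 t0tau dxi _ _ (ltW th_gt0) ga_gt0
  G_all _ G_xi t0th taube).
- have : 0 <= be0 by rewrite (le_trans (ltW th_gt0)).
  lra.
- lra.
- move=> v v1 Kv vt; apply: (G_off (eval_at v)); last by rewrite HK.
  apply: dominated_spectrum => //; exact: (cone_dominated tau0 v1 Kv vt).
Qed.

End LocalMaximum.

(** * Sets of zero area *)

Section PlaneNull.
Variable R : realType.
Local Open Scope ereal_scope.

Local Notation mu := (@lebesgue_measure R \x @lebesgue_measure R).

Let box (p : R * R) (l : R) : set (R * R) :=
  [set` `[p.1 - l, p.1 + l]%R] `*` [set` `[p.2 - l, p.2 + l]%R].

Let box_measurable p l : measurable (box p l).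
Proof. exact: measurableX. Qed.

Let mu_box p l : (0 <= l)%R -> mu (box p l) = ((2 * l) ^+ 2)%:E.
Proof.
move=> l0; rewrite product_measure1E//.
have E (x : R) : lebesgue_measure ([set` `[x - l, x + l]%R] : set R) = (2 * l)%:E.
  rewrite lebesgue_measure_itv /= lte_fin; case: ifPn => [_|].
    by rewrite -EFinB; congr (_%:E); ring.
  by rewrite -leNgt => h; congr (_%:E); lra.
by rewrite expr2 EFinM; congr (_ * _); exact: E.
Qed.

(** Squares rather than measurable sets, because a Lipschitz map sends the coverings
    in the definition of the Hausdorff measure to coverings by squares. *)
Definition thin (T : set (R * R)) : Prop := forall e : R, (0 < e)%R ->
  exists (c : nat -> R * R) (l : nat -> R), [/\ forall i, (0 <= l i)%R,
    forall p, T p -> exists i, (`|p.1 - (c i).1| <= l i /\ `|p.2 - (c i).2| <= l i)%R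
    & \sum_(i <oo) ((l i) ^+ 2)%:E <= e%:E].

(** Thin sets are null for the product of two Lebesgue measures, and squares are
    not. *)
Lemma thin_complement (T : nat -> set (R * R)) : (forall m, thin (T m)) ->
  forall (p : R * R) (e : R), (0 < e)%R -> exists q : R * R,
    [/\ (`|q.1 - p.1| <= e)%R, (`|q.2 - p.2| <= e)%R & forall m, ~ T m q].
Proof.
move=> thinT p e e0.
have neg m : mu.-negligible (T m).
  have /choice[B HB] : forall k : nat, exists B, [/\ measurable B, T m `<=` B &
      mu B <= (k.+1%:R^-1)%:E].
    move=> k; have k0 : (0 < k.+1%:R^-1 / 4 :> R)%R by rewrite divr_gt0// invr_gt0.
    have [c [l [l0 Hc Hl]]] := thinT m _ k0.
    exists (\bigcup_i box (c i) (l i)); split.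
    - exact: bigcup_measurable.
    - move=> q /Hc[i [h1 h2]]; exists i => //; split; rewrite /= in_itv/=.
        by move: h1; rewrite ler_distlC; lra.
      by move: h2; rewrite ler_distlC; lra.
    - have mb i : measurable (box (c i) (l i)) by exact: box_measurable.
      have hB := generalized_Boole_inequality mu mb (bigcup_measurable (fun i _ => mb i)).
      apply: le_trans hB _.
      have -> : (\sum_(i <oo) mu (box (c i) (l i))) = \sum_(i <oo) (4%:E * ((l i) ^+ 2)%:E).
        apply: eq_eseriesr => i _; rewrite mu_box// -EFinM; congr (_%:E).
        by rewrite exprMn; ring.
      rewrite nneseriesZl => [|i _]; last by rewrite lee_fin sqr_ge0.
      rewrite (le_trans (lee_wpmul2l _ Hl))//.
      by rewrite -EFinM lee_fin mulrC divfK.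
  exists (\bigcap_k B k); split.
  - by apply: bigcap_measurable => // k _; case: (HB k).
  - apply/eqP; rewrite eq_le measure_ge0 andbT; apply/lee_addgt0Pr => t t0.
    rewrite add0e; pose k := Num.bound (t^-1)%R.
    have [mB _ Bk] := HB k.
    apply: le_trans (_ : mu (B k) <= _).
      apply: le_measure; rewrite ?inE//; last exact: bigcap_inf.
      by apply: bigcap_measurable => // j _; case: (HB j).
    rewrite (le_trans Bk)// lee_fin invf_ple ?posrE//.
    have kt : (t^-1 < k%:R)%R by rewrite archi_boundP// invr_ge0 ltW.
    by rewrite (le_trans (ltW kt))// ler_nat.
  - by move=> q Tq k _; have [_ sub _] := HB k; exact: sub.
have /negligible_bigcup neg_all := neg.
apply: contrapT => /forallNP H.
have sub : box p e `<=` \bigcup_m T m.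
  move=> q [/= h1 h2]; apply: contrapT => nT; apply: (H q); split.
  - by move: h1; rewrite in_itv/= ler_distlC; lra.
  - by move: h2; rewrite in_itv/= ler_distlC; lra.
  - by move=> m Tm; apply: nT; exists m.
have : mu (box p e) = 0.
  apply: measure_negligible; first exact: box_measurable.
  have [N [mN N0 TN]] := neg_all; exists N; split=> //.
  exact: subset_trans sub TN.
rewrite mu_box ?ltW// => /eqP.
by rewrite eqe sqrf_eq0 mulf_eq0 pnatr_eq0/= gt_eqF.
Qed.

End PlaneNull.

(** * Projections of sets of zero Hausdorff measure *)

Section Lipschitz.
Variables (R : realType) (n : nat).
Local Notation PP := (projective_space R n).
Local Notation V := 'rV[R[i]^o]_n.+1.
Implicit Types (v w z : V).

Definition lin (a : V) v : R[i] := \sum_i (a 0 i : R[i]) * v 0 i.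

Lemma linD a v w : lin a (v + w) = lin a v + lin a w.
Proof. by rewrite -big_split; apply: eq_bigr => i _; rewrite mxE mulrDr. Qed.

Lemma linZ a (c : R[i]) v : lin a (c *: v) = c * lin a v.
Proof. by rewrite mulr_sumr; apply: eq_bigr => i _; rewrite mxE mulrCA. Qed.

Lemma linB a v w : lin a (v - w) = lin a v - lin a w.
Proof. by rewrite linD -scaleN1r linZ mulN1r. Qed.

Definition lin_bound (a : V) : R := \sum_i normc (a 0 i).

Lemma lin_bound_ge0 a : 0 <= lin_bound a.
Proof. by apply: sumr_ge0 => i _; exact: normc_ge0. Qed.

Lemma normc_lin a v : normc (lin a v) <= lin_bound a * hnorm v.
Proof.
rewrite (le_trans (normc_sum _ _ _))// mulr_suml; apply: ler_sum => i _.
by rewrite normcM ler_wpM2l ?normc_ge0 ?hnorm_ge_coord.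
Qed.

Lemma sin_le_id (x : R) : 0 <= x -> sin x <= x.
Proof.
rewrite le_eqVlt => /predU1P[<-|x0]; first by rewrite sin0.
have cs : {within `[0, x], continuous sin}.
  by apply: continuous_subspaceT => y; exact: continuous_sin.
have [c _] := MVT x0 (fun y _ => is_derive_sin y) cs.
by rewrite sin0 !subr0 => ->; rewrite ler_piMl ?cos_le1// ltW.
Qed.

Lemma normc_sqr (x : R[i]) : ((normc x ^+ 2)%:C : R[i]) = x * (x^*)%R.
Proof. by rewrite -sqr_normc normC_normc -rmorphXn. Qed.

Lemma hnorm_sqr v : ((hnorm v ^+ 2)%:C : R[i]) = hdot v v.
Proof.
rewrite /hnorm sqr_sqrtr; last by apply: sumr_ge0 => i _; exact: sqr_ge0.
rewrite rmorph_sum; apply: eq_bigr => i _.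
exact: normc_sqr.
Qed.

Let conjM (x y : R[i]) : ((x * y)^*)%R = (x^* * y^*)%R.
Proof. exact: rmorphM. Qed.

Let conj_swap (x y : R[i]) : (x * y^*)%R = ((y * x^*)^*)%R.
Proof. by rewrite conjM conjCK mulrC. Qed.

Lemma hdotC v w : hdot w v = ((hdot v w)^*)%R.
Proof.
rewrite /hdot rmorph_sum; apply: eq_bigr => i _.
exact: conj_swap.
Qed.

(** Pythagoras for the component of [w] orthogonal to [z]. *)
Lemma hnorm_orthogonal z w : z != 0 ->
  hnorm (w - (hdot w z / hdot z z) *: z) ^+ 2 =
  hnorm w ^+ 2 - normc (hdot z w) ^+ 2 / hnorm z ^+ 2.
Proof.
move=> z0; have hz := hnorm_gt0 z0.
have N0 : hdot z z != 0.
  by rewrite -hnorm_sqr; apply/eqP => -[] /eqP; rewrite expf_eq0 gt_eqF.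
apply: (@complexI R); rewrite hnorm_sqr.
have -> : (hnorm w ^+ 2 - normc (hdot z w) ^+ 2 / hnorm z ^+ 2)%:C =
    hdot w w - hdot z w * hdot w z / hdot z z.
  rewrite rmorphB [X in _ - X]rmorphM fmorphV; congr (_ - _ / _).
  - exact: hnorm_sqr.
  - by rewrite [hdot w z]hdotC; exact: normc_sqr.
  - exact: hnorm_sqr.
set c := hdot w z / hdot z z.
have hdotB x y (t : R[i]) : hdot (x - t *: y) (x - t *: y) =
    hdot x x - t^* * hdot x y - t * hdot y x + t * t^* * hdot y y.
  rewrite /hdot !mulr_sumr -!sumrB -big_split; apply: eq_bigr => i _ /=.
  by rewrite !mxE rmorphB rmorphM; ring.
have cE : (c^*)%R = hdot z w / hdot z z.
  rewrite [in RHS]hdotC [X in _ / X]hdotC.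
  exact: (fmorph_div (@Num.conj R[i])).
by rewrite hdotB cE /c; field.
Qed.

Lemma cauchy_schwarz (x y : V) : x != 0 -> y != 0 ->
  -1 <= normc (hdot x y) / (hnorm x * hnorm y) <= 1.
Proof.
move=> x0 y0; have hx := hnorm_gt0 x0; have hy := hnorm_gt0 y0.
set t := _ / _; have t0 : 0 <= t by rewrite divr_ge0 ?normc_ge0// mulr_ge0 ?ltW.
have t2 : 0 <= 1 - t ^+ 2.
  rewrite -(pmulr_rge0 _ (exprn_gt0 2 hy)).
  have -> : hnorm y ^+ 2 * (1 - t ^+ 2) =
      hnorm y ^+ 2 - normc (hdot x y) ^+ 2 / hnorm x ^+ 2.
    by rewrite /t expr_div_n exprMn; field; rewrite !gt_eqF.
  by rewrite -hnorm_orthogonal// sqr_ge0.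
have t1 : t <= 1 by rewrite -(@ler_sqr _ t 1) ?nnegrE// expr1n; lra.
by rewrite t1 (le_trans _ t0)// lerN10.
Qed.

Lemma fs_dist_ge0 (x y : PP) : 0 <= fs_dist x y.
Proof. by rewrite acos_ge0// cauchy_schwarz ?vec_neq0. Qed.

(** The left-hand side is antisymmetric in the two vectors, so only the component of
    the second one orthogonal to the first one matters; relative to the whole vector
    it has the norm [sin (fs_dist _ _)]. *)
Lemma lipschitz_ratio a b (z w : nonzero_vec R n) :
  normc (lin b (vec z) * lin a (vec w) - lin a (vec z) * lin b (vec w)) <=
  2 * lin_bound a * lin_bound b * hnorm (vec z) * hnorm (vec w) *
  fs_dist (\pi_PP z) (\pi_PP w).
Proof.
rewrite fs_dist_pi; set x := vec z; set y := vec w.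
have hx : 0 < hnorm x by rewrite hnorm_gt0 ?vec_neq0.
have hy : 0 < hnorm y by rewrite hnorm_gt0 ?vec_neq0.
set t := normc (hdot x y) / _.
pose y' := y - (hdot y x / hdot x x) *: x.
have E : hnorm y' ^+ 2 = hnorm y ^+ 2 * (1 - t ^+ 2).
  rewrite hnorm_orthogonal ?vec_neq0// /t expr_div_n exprMn; field.
  by rewrite !gt_eqF.
have t1 : -1 <= t <= 1 by exact: cauchy_schwarz (vec_neq0 z) (vec_neq0 w).
have E' : hnorm y' = hnorm y * sin (acos t).
  rewrite sin_acos// -[LHS]ger0_norm ?hnorm_ge0// -sqrtr_sqr E.
  by rewrite sqrtrM ?sqr_ge0// sqrtr_sqr ger0_norm// ltW.
have -> : lin b x * lin a y - lin a x * lin b y = lin b x * lin a y' - lin a x * lin b y'.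
  by rewrite !linB !linZ; ring.
have y'le : hnorm y' <= hnorm y * acos t.
  by rewrite E' ler_wpM2l ?(ltW hy)// sin_le_id// acos_ge0.
have la := normc_lin a x; have lb := normc_lin b x.
have la' := normc_lin a y'; have lb' := normc_lin b y'.
have a0 := lin_bound_ge0 a; have b0 := lin_bound_ge0 b.
rewrite (le_trans (normcD_le _ _))// normcN_eq !normcM.
apply: (@le_trans _ _ (2 * lin_bound a * lin_bound b * hnorm x * hnorm y')).
  have h1 := ler_pM (normc_ge0 _) (normc_ge0 _) lb la'.
  have h2 := ler_pM (normc_ge0 _) (normc_ge0 _) la lb'.
  by rewrite (le_trans (lerD h1 h2))//; lra.
by rewrite -[leRHS]mulrA ler_wpM2l// !mulr_ge0 ?(ltW hx).
Qed.

End Lipschitz.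

Section AvoidRatio.
Variables (R : realType) (n : nat) (S : set (projective_space R n)).
Hypothesis S_null : (hausdorff2_measure (@fs_dist R n) S <= 0)%E.
Local Notation PP := (projective_space R n).
Local Notation V := 'rV[R[i]^o]_n.+1.

Let small_cover (e : R) : 0 < e -> exists (U : nat -> set PP) (d : nat -> R),
  [/\ S `<=` \bigcup_i U i, forall i, 0 <= d i,
    forall i x y, U i x -> U i y -> fs_dist x y <= d i &
    (\sum_(i <oo) ((d i) ^+ 2)%:E <= e%:E)%E].
Proof.
move=> e0; pose k : R := pi / 4; have k0 : 0 < k by rewrite divr_gt0 ?pi_gt0.
have pre0 : (hausdorff2_pre (@fs_dist R n) 1 S <= 0)%E.
  apply: le_trans S_null; apply: ereal_sup_ubound; exists 1 => //=.
have : (hausdorff2_pre (@fs_dist R n) 1 S < (k * e)%:E)%E.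
  by rewrite (le_lt_trans pre0)// lte_fin mulr_gt0.
move=> /ereal_inf_lt[_ [U [SU diamU] <-] lt].
have diam0 i : (0 <= diam (@fs_dist R n) (U i))%E.
  by apply: ereal_sup_ubound; left.
pose d i := fine (diam (@fs_dist R n) (U i)).
have dE i : diam (@fs_dist R n) (U i) = (d i)%:E.
  by rewrite fineK// ge0_fin_numE// (le_lt_trans (diamU i))// ltry.
exists U, d; split=> // [i|i x y Ux Uy|].
- by rewrite -lee_fin -dE.
- rewrite -lee_fin -dE; apply: ereal_sup_ubound; right; exists x => //.
  by exists y.
- have k1 : 0 <= k^-1 by rewrite invr_ge0 ltW.
  have -> : (\sum_(i <oo) ((d i) ^+ 2)%:E =
      \sum_(i <oo) (k^-1)%:E * ((pi / 4)%:E * diam (@fs_dist R n) (U i) ^+ 2))%E.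
    apply: eq_eseriesr => i _; rewrite dE -EFin_expe -!EFinM mulrA.
    by rewrite mulVf ?mul1r// gt_eqF.
  rewrite nneseriesZl => [|i _]; last first.
    by rewrite mule_ge0 ?lee_fin ?(ltW k0)// expe_ge0.
  rewrite (le_trans (lee_wpmul2l _ (ltW lt))) ?lee_fin//.
  by rewrite mulrA mulVf ?mul1r// gt_eqF.
Qed.

(** The quotient of two linear forms is Lipschitz where the denominator is bounded
    below, so it maps a set of zero Hausdorff 2-measure to a set of zero area. *)
Lemma avoid_ratio (a b : V) (c0 : R[i]) (e : R) : 0 < e -> exists c : R[i],
  normc (c - c0) <= e /\
  forall v, cone S v -> lin a v != 0 -> lin b v != c * lin a v.
Proof.
move=> e0.
pose W m (q : R * R) (z : nonzero_vec R n) := [/\ S (\pi_PP z),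
  hnorm (vec z) <= m.+1%:R * normc (lin a (vec z)) &
  lin b (vec z) = (q.1 +i* q.2) * lin a (vec z)].
pose T m := [set q | exists z, W m q z].
have close m p q z w : W m p z -> W m q w ->
    normc ((p.1 +i* p.2) - (q.1 +i* q.2)) <=
    2 * lin_bound a * lin_bound b * m.+1%:R ^+ 2 * fs_dist (\pi_PP z) (\pi_PP w).
  move=> [_ hz bz] [_ hw bw].
  have := lipschitz_ratio a b z w; rewrite bz bw.
  set x := lin a (vec z) in hz *; set y := lin a (vec w) in hw *.
  set P := p.1 +i* p.2; set Q := q.1 +i* q.2.
  have -> : P * x * y - x * (Q * y) = (P - Q) * (x * y) by ring.
  have z0 := hnorm_gt0 (vec_neq0 z); have w0 := hnorm_gt0 (vec_neq0 w).
  set N := hnorm (vec z) in hz z0 *; set M := hnorm (vec w) in hw w0 *.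
  have x0 : 0 < normc x by rewrite -(@pmulr_rgt0 _ m.+1%:R)// (lt_le_trans z0).
  have y0 : 0 < normc y by rewrite -(@pmulr_rgt0 _ m.+1%:R)// (lt_le_trans w0).
  rewrite !normcM -ler_pdivlMr; last by rewrite mulr_gt0.
  move=> /le_trans; apply; rewrite ler_pdivrMr ?mulr_gt0//.
  set k := fs_dist _ _; have k0 : 0 <= k by exact: fs_dist_ge0.
  have NM := ler_pM (ltW z0) (ltW w0) hz hw.
  have c0' : 0 <= 2 * lin_bound a * lin_bound b * k.
    by rewrite !mulr_ge0 ?lin_bound_ge0.
  by have := ler_wpM2l c0' NM; lra.
have thinT m : thin (T m).
  move=> t t0; pose C := 2 * lin_bound a * lin_bound b * m.+1%:R ^+ 2.
  have C0 : 0 <= C by rewrite !mulr_ge0 ?lin_bound_ge0.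
  have t1 : 0 < t / (C ^+ 2 + 1) by rewrite divr_gt0// ltr_wpDl ?sqr_ge0.
  have [U [d [SU d0 dU sum_d]]] := small_cover t1.
  have /choice[c Hc] : forall i, exists c : R * R, forall p z, W m p z -> U i (\pi_PP z) ->
      normc ((p.1 +i* p.2) - (c.1 +i* c.2)) <= C * d i.
    move=> i; have [[q [w [Wq Uw]]]|none] := pselect (exists q w, W m q w /\ U i (\pi_PP w)).
      exists q => p z Wp Uz; rewrite (le_trans (close _ _ _ _ _ Wp Wq))//.
      by rewrite ler_wpM2l// dU.
    by exists (0, 0) => p z Wp Uz; case: none; exists p, z.
  exists c, (fun i => C * d i); split=> [i|p [z Wz]|].
  - by rewrite mulr_ge0.
  - have [Sz _ _] := Wz; have [i _ Ui] := SU _ Sz; exists i.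
    have H := Hc i p z Wz Ui; split; apply: le_trans H.
      exact: le_trans (normc_ge_absRe ((p.1 +i* p.2) - ((c i).1 +i* (c i).2))).
    exact: le_trans (normc_ge_absIm ((p.1 +i* p.2) - ((c i).1 +i* (c i).2))).
  - have -> : (\sum_(i <oo) ((C * d i) ^+ 2)%:E = \sum_(i <oo) ((C ^+ 2)%:E * ((d i) ^+ 2)%:E))%E.
      by apply: eq_eseriesr => i _; rewrite -EFinM exprMn.
    rewrite nneseriesZl => [|i _]; last by rewrite lee_fin sqr_ge0.
    rewrite (le_trans (lee_wpmul2l _ sum_d)) ?lee_fin ?sqr_ge0//.
    rewrite mulrA ler_pdivrMr; last by rewrite ltr_wpDl ?sqr_ge0.
    by rewrite mulrDr mulr1 [leLHS]mulrC lerDl ltW.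
have e2 : 0 < e / 2 by rewrite divr_gt0.
have [q [h1 h2 nT]] := thin_complement thinT (complex.Re c0, complex.Im c0) e2.
exists (q.1 +i* q.2); split.
  rewrite (le_trans (normc_le_absReIm _))//.
  by move: h1 h2; case: c0 {nT} => x y /=; lra.
move=> v [z <- Sz] a0; apply/eqP => E.
pose m := Num.bound (hnorm (vec z) / normc (lin a (vec z))).
apply: (nT m); exists z; split=> //.
have a0' : 0 < normc (lin a (vec z)) by rewrite normc_gt0.
rewrite -ler_pdivrMr// (le_trans (ltW (archi_boundP _)))// ?divr_ge0 ?hnorm_ge0 ?normc_ge0//.
by rewrite ler_nat.
Qed.

End AvoidRatio.

(** * Topology of the affine cone and of projective space *)

Section ConeTopology.
Variables (R : realType) (n : nat).
Local Notation PP := (projective_space R n).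
Local Notation V := 'rV[R[i]^o]_n.+1.
Implicit Types (v w : V) (r : R).

Definition near_vec v w r : Prop := forall i, normc (w 0 i - v 0 i) < r.

Let posC (e : R[i]) : 0 < e -> exists2 r : R, 0 < r & e = r%:C.
Proof.
case: e => a b; rewrite ltcE /= => /andP[/eqP b0 a0]; exists a => //.
by rewrite b0.
Qed.

Let ballC (x y : R[i]^o) (r : R) : ball x (r%:C : R[i]) y <-> normc (y - x) < r.
Proof.
rewrite -ball_normE /= distrC normC_normc ltcR.
by [].
Qed.

Lemma nbhsC (x : R[i]^o) (A : set R[i]^o) :
  nbhs x A <-> exists2 r, 0 < r & forall y : R[i]^o, normc (y - x) < r -> A y.
Proof.
split=> [/nbhs_ballP[e /posC[r r0 ->] sub]|[r r0 sub]].
  by exists r => // y /ballC/sub.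
apply/nbhs_ballP; exists (r%:C : R[i]) => /=; first by rewrite ltcR.
by move=> y /ballC/sub.
Qed.

Lemma nbhs_vec v (A : set V) :
  nbhs v A <-> exists2 r, 0 < r & forall w, near_vec v w r -> A w.
Proof.
split=> [/nbhs_ballP[e /posC[r r0 ->] sub]|[r r0 sub]].
  exists r => // w vw; apply: sub; split=> [|i j]; first by rewrite ltcR.
  by apply/ballC; rewrite (ord1 i).
apply/nbhs_ballP; exists (r%:C : R[i]) => /=; first by rewrite ltcR.
by move=> w [_ vw]; apply: sub => i; exact/ballC.
Qed.

Lemma open_vec (A : set V) :
  open A <-> forall v, A v -> exists2 r, 0 < r & forall w, near_vec v w r -> A w.
Proof.
rewrite openE; split=> H v /H; first by move/nbhs_vec.
by move=> ?; exact/nbhs_vec.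
Qed.

Definition lipschitz_fun (F : V -> R) : Prop := exists2 L : R, 0 <= L &
  forall v w r, 0 < r -> near_vec v w r -> `|F w - F v| <= L * r.

Lemma lipschitz_normc_lin (a : V) (c : R[i]) : lipschitz_fun (fun v => normc (lin a v - c)).
Proof.
exists (lin_bound a); first exact: lin_bound_ge0.
move=> v w r r0 vw; have Hd x y : normc x - normc y <= normc (x - y) :> R.
  by have := normcB_ge x (- y); rewrite normcN_eq.
have H : normc (lin a w - lin a v) <= lin_bound a * r.
  rewrite -linB (le_trans (normc_sum _ _ _))// mulr_suml; apply: ler_sum => i _.
  rewrite normcM ler_wpM2l ?normc_ge0// mxE mxE; exact: ltW (vw i).
have E1 : lin a w - c - (lin a v - c) = lin a w - lin a v by ring.
have E2 : lin a v - c - (lin a w - c) = - (lin a w - lin a v) by ring.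
have := Hd (lin a w - c) (lin a v - c); have := Hd (lin a v - c) (lin a w - c).
rewrite E1 E2 normcN_eq => h1 h2; rewrite ler_norml; apply/andP; split; lra.
Qed.

Lemma lipschitzD F G : lipschitz_fun F -> lipschitz_fun G -> lipschitz_fun (F \+ G).
Proof.
move=> [L L0 HL] [M M0 HM]; exists (L + M); first exact: addr_ge0.
move=> v w r r0 vw; rewrite /= opprD addrACA (le_trans (ler_normD _ _))// mulrDl.
by rewrite lerD ?HL ?HM.
Qed.

Lemma lipschitzZ (c : R) F : lipschitz_fun F -> lipschitz_fun (fun v => c * F v).
Proof.
move=> [L L0 HL]; exists (`|c| * L); first by rewrite mulr_ge0.
by move=> v w r r0 vw; rewrite -mulrBr normrM -mulrA ler_wpM2l// HL.
Qed.

Lemma lipschitz_sum (I : Type) (s : seq I) (F : I -> V -> R) :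
  (forall i, lipschitz_fun (F i)) -> lipschitz_fun (fun v => \sum_(i <- s) F i v).
Proof.
move=> H; elim: s => [|i s IH].
  by exists 0 => // v w r r0 _; rewrite !big_nil subrr normr0 mul0r.
rewrite (_ : (fun v => _) = F i \+ (fun v => \sum_(i <- s) F i v)).
  exact: lipschitzD.
by apply/funext => v; rewrite big_cons.
Qed.

Lemma lipschitz_open F (c : R) : lipschitz_fun F -> open [set v | c < F v].
Proof.
move=> [L L0 HL]; apply/open_vec => v /= cv.
have r0 : 0 < (F v - c) / (L + 1) by rewrite divr_gt0//; lra.
exists ((F v - c) / (L + 1)) => // w vw; have := HL _ _ _ r0 vw.
rewrite mulrA ler_norml => /andP[+ _]; rewrite -(@ler_pM2r _ (L + 1)); last lra.
rewrite mulNr divfK; last lra.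
by nra.
Qed.

Let plane_map (p : R * R) : R[i]^o := p.1 +i* p.2.

Let plane_map_continuous : continuous plane_map.
Proof.
move=> [a b] A /nbhsC[r r0 sub].
exists (ball a (r / 2), ball b (r / 2)).
  by split; apply: nbhsx_ballx; rewrite divr_gt0.
move=> [x y] [/= ax bY]; apply: sub; rewrite (le_lt_trans (normc_le_absReIm _))//=.
rewrite (distrC x) (distrC y); move: ax bY; rewrite -!ball_normE /=; lra.
Qed.

Definition in_square (M : R) v : Prop :=
  forall i, `|complex.Re (v 0 i)| <= M /\ `|complex.Im (v 0 i)| <= M.

Lemma compact_square M : compact [set v | in_square M v].
Proof.
pose Q := [set c : R[i]^o | `|complex.Re c| <= M /\ `|complex.Im c| <= M].
have cQ : compact Q.
  have -> : Q = plane_map @` ([set` `[- M, M]] `*` [set` `[- M, M]]).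
    rewrite eqEsubset; split=> [[x y] [/= hx hy]|_ [[x y] [/= hx hy] <-]].
      by exists (x, y) => //; split; rewrite /= in_itv/= -ler_norml.
    by split; rewrite /= ler_norml; [move: hx | move: hy]; rewrite in_itv.
  apply: continuous_compact; first exact: continuous_subspaceT plane_map_continuous.
  by apply: compact_setX; exact: segment_compact.
exact: (rV_compact (A := fun=> Q) (fun=> cQ)).
Qed.

(** Compactness turns the absence of zeros into a lower bound. All closed conditions
    other than boundedness are to be expressed through the open set [O]. *)
Lemma gap (O : set V) (M : R) (a : V) (c : R[i]) : open O ->
  (forall v, in_square M v -> ~ O v -> lin a v != c) ->
  exists2 delta : R, 0 < delta &
    forall v, in_square M v -> ~ O v -> delta <= normc (lin a v - c).
Proof.
move=> oO H; pose W := [set v | in_square M v] `&` ~` O.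
have cW : compact W.
  apply: (subclosed_compact _ (@compact_square M)); last by move=> v [].
  apply: closedI; last exact: open_closedC.
  apply: compact_closed; last exact: compact_square.
  exact: norm_hausdorff.
pose F v : R := normc (lin a v - c).
have [L L0 HL] := lipschitz_normc_lin a c.
have [[w Ww]|none] := pselect (exists v, W v); last first.
  by exists 1 => // v v1 v2; case: none; exists v.
have cF : continuous F.
  move=> v A /nbhs_ballP[e /= e0 sub]; apply/nbhs_vec.
  have L1 : 0 < L + 1 by lra.
  have e1 : 0 < e / (L + 1) by rewrite divr_gt0.
  exists (e / (L + 1)) => // w' vw; apply: sub; rewrite -ball_normE /= distrC.
  apply: (le_lt_trans (HL v w' _ e1 vw)).
  by rewrite mulrA ltr_pdivrMr// mulrC ltr_pM2l//; lra.
have W0 : W !=set0 by exists w.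
have [v /set_mem Wv vmin] := compact_EVT_min W0 cW (continuous_subspaceT cF).
exists (F v) => [|x x1 x2]; last by apply: vmin; exact: mem_set.
by have [v1 v2] := Wv; rewrite normc_gt0 subr_eq0 H.
Qed.

End ConeTopology.

Section ProjectiveTopology.
Variables (R : realType) (n : nat).
Local Notation PP := (projective_space R n).
Local Notation V := 'rV[R[i]^o]_n.+1.
Implicit Types (v w : V) (z : nonzero_vec R n).

Lemma open_lift (U : set PP) : open U ->
  exists2 O : set V, open O & forall z, U (\pi_PP z) <-> O (vec z).
Proof.
move=> [B oB E]; exists B => // z.
by have /seteqP[BE EB] := E; split; [exact: EB | exact: BE].
Qed.

Lemma lift_open (U : set PP) (O : set V) : open O ->
  (forall z, U (\pi_PP z) <-> O (vec z)) -> open U.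
Proof.
by move=> oB E; exists O => //; apply/seteqP; split=> z /E.
Qed.

Definition homogeneous (F : V -> R) : Prop :=
  forall (c : R[i]) v, F (c *: v) = normc c * F v.

Definition pos_locus (F : V -> R) : set PP := [set y | 0 < F (vec (repr y))].

Lemma pos_locus_pi F z : homogeneous F -> pos_locus F (\pi_PP z) <-> 0 < F (vec z).
Proof.
move=> hF; rewrite /pos_locus /=; have [c c0 ->] := vec_repr z.
by rewrite hF pmulr_rgt0// normc_gt0.
Qed.

Lemma pos_locus_open F : homogeneous F -> lipschitz_fun F -> open (pos_locus F).
Proof.
move=> hF lF; apply: (lift_open (O := [set v | 0 < F v])) => [|z].
  exact: lipschitz_open.
exact: pos_locus_pi.
Qed.

Definition coord_form (j : 'I_n.+1) : V := delta_mx 0 j.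

Lemma lin_coord j v : lin (coord_form j) v = v 0 j.
Proof.
rewrite /lin (bigD1 j)//= mxE !eqxx mul1r big1 ?addr0// => i ij.
by rewrite mxE eqxx (negbTE ij) mul0r.
Qed.

Lemma linDl (a b : V) v : lin (a + b) v = lin a v + lin b v.
Proof. by rewrite -big_split; apply: eq_bigr => i _; rewrite mxE mulrDl. Qed.

Lemma linZl (c : R[i]) (a : V) v : lin (c *: a) v = c * lin a v.
Proof. by rewrite mulr_sumr; apply: eq_bigr => i _; rewrite mxE mulrA. Qed.

Lemma linBl (a b : V) v : lin (a - b) v = lin a v - lin b v.
Proof. by rewrite linDl -scaleN1r linZl mulN1r. Qed.

Lemma homogeneous_normc_lin a : homogeneous (fun v => normc (lin a v)).
Proof. by move=> c v; rewrite linZ normcM. Qed.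

Lemma lipschitz_normc a : lipschitz_fun (fun v => normc (lin a v)).
Proof.
rewrite (_ : (fun _ => _) = fun v => normc (lin a v - 0)).
  exact: lipschitz_normc_lin.
by apply/funext => v; rewrite subr0.
Qed.

Lemma lipschitzB F G : lipschitz_fun F -> lipschitz_fun G ->
  lipschitz_fun (fun v : V => F v - G v).
Proof.
move=> lF lG; have := lipschitzD lF (lipschitzZ (-1) lG).
by congr lipschitz_fun; apply/funext => v /=; rewrite mulN1r.
Qed.

(** Two points of projective space are separated by the size of a minor of their
    coordinates, relative to that of the vector. *)
Lemma projective_hausdorff : hausdorff_space PP.
Proof.
rewrite open_hausdorff => x y xy.
set z := repr x; set w := repr y.
have [i wi] : exists i, vec w 0 i != 0 by apply/rV0Pn; exact: vec_neq0.
have [j zj] : exists j, vec z 0 j * vec w 0 i - vec z 0 i * vec w 0 j != 0.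
  apply: contrapT => none; move/eqP: xy; apply.
  rewrite -(reprK x) -(reprK y); apply: (@pi_eq _ _ z w (vec z 0 i / vec w 0 i)).
  apply/rowP => j; rewrite mxE -/z -/w; apply: (mulIf wi).
  have -> : vec z 0 i / vec w 0 i * vec w 0 j * vec w 0 i = vec z 0 i * vec w 0 j.
    by field.
  by apply/eqP; rewrite -subr_eq0; apply: contrapT => h; apply: none; exists j; apply/negP.
pose a : V := vec w 0 i *: coord_form j - vec w 0 j *: coord_form i.
have aE v : lin a v = v 0 j * vec w 0 i - v 0 i * vec w 0 j.
  by rewrite linBl !linZl !lin_coord mulrC; congr (_ - _); rewrite mulrC.
pose s v : R := \sum_k normc (lin (coord_form k) v).
have sE v : v != 0 -> 0 < s v.
  move=> /rV0Pn[k vk]; rewrite /s (bigD1 k)//= ltr_wpDr ?sumr_ge0// => [l _|].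
    exact: normc_ge0.
  by rewrite lin_coord normc_gt0.
have hs : homogeneous s.
  move=> c v; rewrite /s mulr_sumr; apply: eq_bigr => k _.
  exact: homogeneous_normc_lin.
have ls : lipschitz_fun s by apply: lipschitz_sum => k; exact: lipschitz_normc.
have sz := sE _ (vec_neq0 z); have sw := sE _ (vec_neq0 w).
have az0 : 0 < normc (lin a (vec z)) by rewrite aE normc_gt0.
pose d := normc (lin a (vec z)) / (2 * s (vec z)).
have d0 : 0 < d by rewrite divr_gt0// mulr_gt0.
pose F v : R := normc (lin a v) - d * s v.
have hF : homogeneous F.
  by move=> c v; rewrite /F homogeneous_normc_lin hs; ring.
have lF : lipschitz_fun F.
  by apply: lipschitzB; [exact: lipschitz_normc | exact: lipschitzZ].
pose G v := -1 * F v.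
have hG : homogeneous G by move=> c v; rewrite /G hF; ring.
have lG : lipschitz_fun G by exact: lipschitzZ.
exists (pos_locus F, pos_locus G) => /=.
  split; rewrite inE /pos_locus /=.
    rewrite /F -/z subr_gt0 /d mulrAC ltr_pdivrMr ?mulr_gt0// mulrCA.
    by rewrite ltr_pMl// ?mulr_gt0//; lra.
  rewrite /G /F -/w mulN1r opprB subr_gt0 aE mulrC subrr normc0.
  by rewrite mulr_gt0.
split; [exact: pos_locus_open | exact: pos_locus_open|].
apply/eqP; rewrite -subset0 => t [/= h1 h2]; move: h1 h2; rewrite /pos_locus /= /G; lra.
Qed.

End ProjectiveTopology.

(** * The hull near a point outside of [K] *)

Section Assembly.
Variables (R : realType) (n : nat).
Local Notation PP := (projective_space R n).
Local Notation V := 'rV[R[i]^o]_n.+1.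
Local Notation poly := (mpoly.mpoly n.+1 R[i]).
Implicit Types (v w : V).

Section GenericForm.
Variables (i0 : 'I_n.+1) (z0 : V).
Hypothesis z01 : z0 0 i0 = 1.

Definition diff_form (j : 'I_n.+1) : V := coord_form R j - z0 0 j *: coord_form R i0.

Lemma lin_diff j v : lin (diff_form j) v = v 0 j - z0 0 j * v 0 i0.
Proof. by rewrite linBl linZl !lin_coord. Qed.

(** A hyperplane through [z0] that meets [S] at most at the point of [z0]. Its form
    is a combination of the [diff_form j], which are added one at a time, each time
    with a coefficient that avoids the values on [S] of a quotient of two forms. *)
Lemma generic_form (S : set PP) : (hausdorff2_measure (@fs_dist R n) S <= 0)%E ->
  exists f : V, lin f z0 = 0 /\
    forall v, cone S v -> lin f v = 0 -> v = v 0 i0 *: z0.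
Proof.
move=> S0; suff [f [fz Hf]] : exists f : V, lin f z0 = 0 /\
    forall v, cone S v -> lin f v = 0 -> forall j, j \in enum 'I_n.+1 -> lin (diff_form j) v = 0.
  exists f; split=> // v Sv fv; apply/rowP => j.
  have := Hf v Sv fv j; rewrite mem_enum => /(_ isT); rewrite lin_diff => /eqP.
  by rewrite subr_eq0 mxE mulrC => /eqP.
elim: (enum _) => [|j s [g [gz Hg]]].
  exists 0; split=> //; rewrite /lin big1// => i _; by rewrite mxE mul0r.
have [c [_ Hc]] := avoid_ratio S0 g (diff_form j) 0 ltr01.
exists (diff_form j - c *: g); split.
  by rewrite linBl linZl gz lin_diff z01 !mulr1 mulr0 subrr subr0.
move=> v Sv /eqP; rewrite linBl linZl subr_eq0 => /eqP E k.
have gv : lin g v = 0.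
  by apply/eqP; apply: contraT => gv; have := Hc v Sv gv; rewrite E eqxx.
rewrite inE => /predU1P[->|ks]; last exact: Hg.
by rewrite E gv mulr0.
Qed.

End GenericForm.

Definition form_poly (f : V) : poly := \sum_j (f 0 j : R[i]) *: coordp R j.

Lemma ev_form_poly f v : ev (form_poly f) v = lin f v.
Proof. by rewrite ev_sum; apply: eq_bigr => j _; rewrite evZ ev_coordp. Qed.

Definition cell_functions (f z0 : V) (eps r : R) : seq poly :=
  (eps^-1)%:C *: form_poly f ::
  [seq (r^-1)%:C *: (coordp R j - (z0 0 j : R[i]) *: 1) | j <- enum 'I_n.+1].

Let normc_div (t : R) (x : R[i]) : 0 < t -> normc ((t^-1)%:C * x) = normc x / t.
Proof. by move=> t0; rewrite normcM normc_real ?invr_ge0 ?ltW// mulrC. Qed.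

Lemma in_cellP (f z0 : V) (eps r : R) v : 0 < eps -> 0 < r ->
  in_cell (cell_functions f z0 eps r) (eval_at v) <->
  normc (lin f v) <= eps /\ forall j, normc (v 0 j - z0 0 j) <= r.
Proof.
move=> e0 r0; rewrite /= /eval_at evZ normc_div// ler_pdivrMr// mul1r ev_form_poly.
split=> [/andP[-> /allP H]|[-> H]] /=.
  split=> // j; have := H _ (map_f _ (mem_enum 'I_n.+1 j)).
  by rewrite evZ normc_div// ler_pdivrMr// mul1r evB evZ ev1 mulr1 ev_coordp.
apply/allP => _ /mapP[j _ ->].
by rewrite evZ normc_div// ler_pdivrMr// mul1r evB evZ ev1 mulr1 ev_coordp.
Qed.

Lemma in_shellP (f z0 : V) (eps r : R) v : 0 < eps -> 0 < r ->
  in_shell (cell_functions f z0 eps r) (eval_at v) ->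
  eps / 2 <= normc (lin f v) \/ exists j, r / 2 <= normc (v 0 j - z0 0 j).
Proof.
move=> e0 r0; rewrite /= /eval_at evZ normc_div// ler_pdivlMr// ev_form_poly.
move=> /orP[h|/hasP[_ /mapP[j _ ->]]]; first by left; lra.
rewrite evZ normc_div// ler_pdivlMr// evB evZ ev1 mulr1 ev_coordp => h.
by right; exists j; lra.
Qed.

Let sum_ge_term (F : 'I_n.+1 -> R) j : (forall k, 0 <= F k) -> F j <= \sum_k F k.
Proof. by move=> F0; rewrite (bigD1 j)//= lerDl sumr_ge0. Qed.

Let quarter_bound (e t x y : R) : 0 < e -> 1 <= t ->
  x <= e / 8 -> y <= e / 8 / (32 * t) -> x + y <= e / 4.
Proof.
move=> e0 t1 hx hy; have : e / 8 / (32 * t) <= e / 8.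
  by rewrite ler_pdivrMr ?ler_peMr//; lra.
lra.
Qed.

Let shell_bound (e x y : R) : e / 2 <= x -> y <= e / 4 -> e / 4 <= x - y.
Proof. lra. Qed.

Let not_larger (e t x : R) : 0 < e -> 1 <= t -> x <= e / 8 / (32 * t) ->
  e / 4 < 32 * t * x -> False.
Proof. by move=> e0 t1; rewrite ler_pdivlMr; lra. Qed.

(** If the set had measure zero, a linear form [f] would vanish on it only at [x], and
    a value [c] close to [f xi] would be omitted by [f]. In a polydisc around [x] with
    a small bound [eps] on [f], the hull meets the boundary only where [|f| = eps], so
    [1 / (f - c)] would violate the local maximum principle. *)
Theorem hull_measure_pos (K : set PP) (x : PP) (U : set PP) : compact K ->
  closure (projective_hull K) x -> ~ K x -> open U -> U x ->
  ~ (hausdorff2_measure (@fs_dist R n)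
      ((closure (projective_hull K) `\` K) `&` U) <= 0)%E.
Proof.
set hull := projective_hull K; set S := (_ `&` U); move=> cK Ex nKx oU Ux S0.
have [i0 zi0] : exists i, vec (repr x) 0 i != 0 by apply/rV0Pn; exact: vec_neq0.
pose z0 : V := (vec (repr x) 0 i0)^-1 *: vec (repr x).
have z01 : z0 0 i0 = 1 by rewrite mxE mulVf.
have neq0 v : v 0 i0 = 1 -> v != 0.
  by move=> v1; apply/eqP => v0; move: v1; rewrite v0 mxE => /esym/eqP; rewrite oner_eq0.
have [z zE] := vec_ex (neq0 _ z01).
have zx : \pi_PP z = x by rewrite -[RHS]reprK; exact: pi_eq zE.
(* From here on the closed hull and [U] without [K] are described by the open sets
   of vectors [OE] and [OU]. *)
have [OE oOE OEP] := open_lift (closed_openC (@closed_closure _ hull)).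
have oUK : open (U `&` ~` K).
  by apply: openI => //; apply: closed_openC; apply: compact_closed => //; exact: projective_hausdorff.
have [OU oOU OUP] := open_lift oUK.
have OUz : OU z0 by rewrite -zE; apply/OUP; rewrite zx.
have [r r0 Hr] := (open_vec OU).1 oOU _ OUz.
have [r1 r10 r1r] : exists2 r1, 0 < r1 & r1 < r by exists (r / 2); lra.
have near_U v : (forall j, normc (v 0 j - z0 0 j) <= r1) -> OU v.
  by move=> H; apply: Hr => j; exact: le_lt_trans (H j) r1r.
have cone_U v : v 0 i0 = 1 -> OU v -> cone (U `&` ~` K) v.
  by move=> v1 Ov; have [t tv] := vec_ex (neq0 _ v1); exists t => //; apply/OUP; rewrite tv.
have cone_E v : v 0 i0 = 1 -> ~ OE v -> cone (closure hull) v.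
  move=> v1 Ov; have [t tv] := vec_ex (neq0 _ v1); exists t => //.
  by apply: contrapT => nE; apply: Ov; rewrite -tv; apply/OEP.
have cone_S v : v 0 i0 = 1 -> ~ OE v -> (forall j, normc (v 0 j - z0 0 j) <= r1) -> cone S v.
  move=> v1 Ov H; have [t tv Et] := cone_E v v1 Ov; exists t => //.
  have [Ut nK] : (U `&` ~` K) (\pi_PP t) by apply/OUP; rewrite tv; exact: near_U.
  by split.
have hull_OE v : cone hull v -> ~ OE v.
  by move=> [t <- ht] /OEP; apply; exact: subset_closure.
have [f [fz Hf]] := generic_form z01 S0.
pose M := lin_bound z0 + r1.
have square v : (forall j, normc (v 0 j - z0 0 j) <= r1) -> in_square M v.
  move=> H j; have vM : normc (v 0 j) <= M.
    rewrite -(subrK (z0 0 j) (v 0 j)) (le_trans (normcD_le _ _))// /M addrC lerD//.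
    by apply: (sum_ge_term (F := fun k => normc (z0 0 k))) => k; exact: normc_ge0.
  by rewrite (le_trans (normc_ge_absRe _) vM) (le_trans (normc_ge_absIm _) vM).
(* Outside of [O2] are the vectors over the closed hull that lie in a polydisc of the
   chart; [O1] also contains a neighbourhood of [z0]. *)
pose O2 : set V := OE `|` ([set v | 0 < normc (lin (coord_form R i0) v - 1)] `|`
  \bigcup_j [set v | r1 < normc (lin (coord_form R j) v - z0 0 j)]).
have oO2 : open O2.
  apply: openU => //; apply: openU; first exact: lipschitz_open (lipschitz_normc_lin _ _).
  by apply: bigcup_open => j _; exact: lipschitz_open (lipschitz_normc_lin _ _).
have O2P v : ~ O2 v <-> [/\ ~ OE v, v 0 i0 = 1 & forall j, normc (v 0 j - z0 0 j) <= r1].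
  split=> [nO|[nE v1 H]].
    split=> [Ov||j]; first by apply: nO; left.
      apply: contrapT => v1; apply: nO; right; left => /=.
      by rewrite lin_coord normc_gt0 subr_eq0; apply/eqP.
    rewrite leNgt; apply/negP => h; apply: nO; right; right; exists j => //=.
    by rewrite lin_coord.
  move=> [//|[|[j _]]] /=; rewrite lin_coord.
    by rewrite v1 subrr normc0 ltxx.
  by rewrite ltNge H.
pose D v : R := \sum_j normc (lin (coord_form R j) v - z0 0 j).
pose O1 : set V := O2 `|` [set v | - (r1 / 2) < -1 * D v].
have oO1 : open O1.
  apply: openU => //; apply: lipschitz_open; apply: lipschitzZ.
  by apply: lipschitz_sum => j; exact: lipschitz_normc_lin.
have [|e1 e10 He1] := gap (a := f) (c := 0) (M := M) oO1.
  move=> v _ nO1; have /O2P[nE v1 H] : ~ O2 v by move=> h; apply: nO1; left.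
  apply/eqP => fv; have := Hf v (cone_S v v1 nE H) fv; rewrite v1 scale1r => vz.
  apply: nO1; right => /=; rewrite vz /D big1 ?mulr0 ?oppr_lt0 ?divr_gt0// => j _.
  by rewrite lin_coord subrr normc0.
have [eps eps0 eps_e1] : exists2 eps, 0 < eps & eps < e1.
  by exists (e1 / 2); rewrite ?divr_gt0// ltr_pdivrMr// ltr_pMr// ltr1n.
pose hs := cell_functions f z0 eps r1.
(* [x] is only in the closure of the hull, and the growth estimates need a point of
   the hull itself. The point [xi] is so close to [x] that [f] is small there. *)
have [r2 [r20 r2r1 r2eps]] : exists r2, [/\ 0 < r2, r2 <= r1 & r2 <= eps / 8].
  exists (Num.min r1 (eps / 8)); rewrite lt_min r10 divr_gt0//.
  by rewrite !ge_min !lexx orbT.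
pose F v : R := r2 * normc (lin (coord_form R i0) v) -
  (\sum_j normc (lin (diff_form i0 z0 j) v) + normc (lin f v)).
have lF : lipschitz_fun F.
  apply: lipschitzB; first exact: lipschitzZ (lipschitz_normc _).
  apply: (@lipschitzD _ _ (fun v => \sum_j normc (lin (diff_form i0 z0 j) v))).
    by apply: lipschitz_sum => j; exact: lipschitz_normc.
  exact: lipschitz_normc.
have hF : homogeneous F.
  move=> c v; rewrite /F !homogeneous_normc_lin.
  under eq_bigr => j _ do rewrite homogeneous_normc_lin.
  by rewrite -mulr_sumr; ring.
have Fz : 0 < F z0.
  rewrite /F lin_coord z01 normc1 fz normc0 big1 ?addr0 ?subr0 ?mulr1// => j _.
  by rewrite lin_diff z01 mulr1 subrr normc0.
have nx : nbhs x (pos_locus F).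
  apply: open_nbhs_nbhs; split; first exact: pos_locus_open.
  by rewrite -zx; apply/pos_locus_pi; rewrite ?zE.
have [y [hy Fy]] := Ex _ nx.
pose w := vec (repr y); rewrite /pos_locus /= -/w in Fy.
have rest v : 0 <= \sum_j normc (lin (diff_form i0 z0 j) v).
  by apply: sumr_ge0 => j _; exact: normc_ge0.
have wi0 : w 0 i0 != 0.
  apply/eqP => w0; move: Fy; rewrite /F lin_coord w0 normc0 mulr0 sub0r oppr_gt0.
  by rewrite ltNge addr_ge0 ?normc_ge0.
pose xi : V := (w 0 i0)^-1 *: w.
have xi1 : xi 0 i0 = 1 by rewrite mxE mulVf.
have hxi : cone hull xi by apply: coneZ; [rewrite invr_eq0 | exact/cone_repr].
have Fxi : 0 < F xi by rewrite hF mulr_gt0// normc_gt0 invr_eq0.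
have Fxi' : \sum_j normc (lin (diff_form i0 z0 j) xi) + normc (lin f xi) < r2.
  by move: Fxi; rewrite /F lin_coord xi1 normc1 mulr1 subr_gt0.
have fxi : normc (lin f xi) < eps / 8.
  apply: lt_le_trans r2eps.
  by apply: le_lt_trans Fxi'; rewrite lerDr rest.
have xi_near j : normc (xi 0 j - z0 0 j) <= r1.
  apply: le_trans r2r1.
  apply: le_trans (ltW Fxi'); apply: (@le_trans _ _ (normc (lin (diff_form i0 z0 j) xi))).
    rewrite lin_diff xi1 mulr1; exact: lexx.
  apply: (le_trans (sum_ge_term (F := fun k => normc (lin (diff_form i0 z0 k) xi)) _ _)).
    by move=> k; exact: normc_ge0.
  by rewrite lerDl normc_ge0.
have fxi_eps : normc (lin f xi) <= eps.
  by rewrite (le_trans (ltW fxi))// ler_pdivrMr// ler_peMr ?ler1n// ltW.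
have cellP v := in_cellP f z0 v eps0 r10.
have cxi : in_cell hs (eval_at xi) := (cellP xi).2 (conj fxi_eps xi_near).
have [tau tau0 dom] := hull_dominated hxi.
have [t0 t01 tau_t0] : exists2 t0, 1 <= t0 & tau <= t0.
  by exists (Num.max 1 tau); rewrite le_max lexx ?orbT.
have dxi : dominated K t0 xi := dominatedW tau0 tau_t0 dom.
have t00 : 0 < t0 := lt_le_trans ltr01 t01.
have e0 : 0 < eps / 8 / (32 * t0) by rewrite !divr_gt0// mulr_gt0.
(* [1 / (f - c)] has no poles on the hull in the polydisc, and it is larger at [xi]
   than on the shell by more than the factor allowed by [local_maximum]. *)
have [c [cxi' Hc]] := avoid_ratio S0 (coord_form R i0) f (lin f xi) e0.
have c_small : normc c <= eps / 4.
  rewrite -(subrKC (lin f xi) c) (le_trans (normcD_le _ _))//.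
  exact: quarter_bound eps0 t01 (ltW fxi) cxi'.
pose u := form_poly f - c *: 1.
have uE v : ev u v = lin f v - c by rewrite evB evZ ev1 mulr1 ev_form_poly.
have [|delta delta0 Hdelta] := gap (a := f) (c := c) (M := M) oO2.
  move=> v _ /O2P[nE v1 H]; have := Hc v (cone_S v v1 nE H).
  by rewrite lin_coord v1 mulr1 oner_eq0; apply.
have eps40 : 0 < eps / 4 by rewrite divr_gt0.
have HK v : v 0 i0 = 1 -> cone K v -> ~~ in_cell hs (eval_at v).
  move=> v1 Kv; apply/negP => /cellP[_ H].
  have [t tv [_ nK]] := cone_U v v1 (near_U v H); apply: nK.
  by apply/cone_pi; rewrite tv.
have Hu v : v 0 i0 = 1 -> cone hull v -> in_cell hs (eval_at v) -> delta <= normc (ev u v).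
  move=> v1 hv /cellP[_ H]; rewrite uE; apply: Hdelta; first exact: square.
  by apply/O2P; split; [exact: hull_OE| |].
have Hshell v : v 0 i0 = 1 -> cone hull v -> in_cell hs (eval_at v) ->
    in_shell hs (eval_at v) -> eps / 4 <= normc (ev u v).
  move=> v1 hv /cellP[fe H] /(in_shellP eps0 r10)[h|[j hj]].
    rewrite uE; apply: le_trans (normcB_ge _ _); rewrite normcN_eq.
    exact: shell_bound.
  have far : e1 <= normc (lin f v - 0).
    apply: He1; first exact: square.
    move=> [|] /=; first by apply/O2P; split; [exact: hull_OE| |].
    rewrite mulN1r ltrN2 ltNge (le_trans hj)// -(lin_coord j v).
    apply: (sum_ge_term (F := fun k => normc (lin (coord_form R k) v - z0 0 k))) => k.
    exact: normc_ge0.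
  by move: far; rewrite subr0 leNgt (le_lt_trans fe eps_e1).
have := local_maximum xi1 t01 dxi cxi delta0 eps40 HK Hu Hshell.
have h1 : normc (ev u xi) <= eps / 8 / (32 * t0) by rewrite uE -normcN_eq opprB.
exact: not_larger eps0 t01 h1.
Qed.

End Assembly.

Local Open Scope classical_set_scope.
Local Open Scope ring_scope.

Theorem corollary1 (R : realType) (n : nat) (K : set (projective_space R n))
    (hK : compact K) :
  forall x : projective_space R n,
    (closure (projective_hull K) `\` K) x ->
  forall U : set (projective_space R n), open U -> U x ->
    (0 < hausdorff2_measure (@fs_dist R n)
           ((closure (projective_hull K) `\` K) `&` U))%E.
Proof.
move=> x [Ex nKx] U oU Ux; rewrite ltNge; apply/negP.
exact: (hull_measure_pos hK Ex nKx oU Ux).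
Qed.
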